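(* Let $\mathcal{D}$ be a holomorphic distribution on $\mathbb{P}^{n}$ such that $T_{\mathcal{D}}\cong\bigoplus_i T_{\mathcal{F}_i}$, where each $\mathcal{F}_i$ is a one-dimensional holomorphic foliation whose singular set has only isolated singularities. Let $\mathcal{G}$ be a Pfaff system on $\mathbb{P}^{n}$ that leaves $\mathcal{D}$ invariant. Then $$\deg(\mathcal{D})\le\dim(\mathcal{D})\cdot\deg(\mathcal{G}).$$
   Context: $\mathbb{P}^n$ is complex projective space. A Pfaff system of codimension $k$ ($1\le k\le n-1$) on $\mathbb{P}^{n}$ is induced by a nonzero section $\omega\in H^{0}(\mathbb{P}^{n},\Omega^{k}_{\mathbb{P}^{n}}(l))$; its singular set is the zero set of $\omega$ and its degree is $l-k-1$. A holomorphic distribution of codimension $k$ (dimension $n-k$) is a Pfaff system whose form $\omega$ is, locally outside its singular set, a wedge product of $k$ holomorphic $1$-forms; its tangent sheaf is $T_{\mathcal{D}}=\mathrm{Ker}(\omega)=\{v\in T_{\mathbb{P}^{n}} : i_v\omega=0\}$. Distributions are assumed to be reduced (singular set of codimension at least $2$) and to have nonempty singular set. A one-dimensional holomorphic foliation $\mathcal{F}_i$ of degree $d_i$ is induced by a section $X_i\in H^{0}(\mathbb{P}^{n},T_{\mathbb{P}^{n}}(d_i-1))$, so $T_{\mathcal{F}_i}\cong\mathcal{O}_{\mathbb{P}^{n}}(1-d_i)$; the summands $T_{\mathcal{F}_i}$ are the tangent sheaves of foliations tangent to $\mathcal{D}$. A Pfaff system $\mathcal{G}$ given by $\omega_{\mathcal{G}}$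 leaves $\mathcal{D}$ (given by $\omega_{\mathcal{D}}$) invariant, i.e. $\mathcal{D}\prec\mathcal{G}$ is a flag, if $\mathrm{codim}(\mathcal{G})<\mathrm{codim}(\mathcal{D})$ and $\mathrm{Ker}(\omega_{\mathcal{D}})\subset\mathrm{Ker}(\omega_{\mathcal{G}})$ outside their singular sets. *)

(* Defs.v *)
From HB Require Import structures.
From mathcomp Require Import all_boot all_order all_algebra.
From mathcomp Require Import fraction complex.
(* The notations of mpoly clash with those of the analysis library. *)
From mathcomp Require Import -(notations) mpoly.
From mathcomp Require Import all_classical all_reals all_analysis.

Set Implicit Arguments.
Unset Strict Implicit.
Unset Printing Implicit Defensive.

Import Order.TTheory GRing.Theory Num.Theory.
Import numFieldNormedType.Exports.
Local Open Scope classical_set_scope.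
Local Open Scope ring_scope.

(* The complex numbers R[i], packed as a numClosedFieldType so that the generic
   numFieldType instances of the analysis library apply and provide the usual
   topology, and complex differentiability. *)
Definition CC (R : realType) : numClosedFieldType := R[i].

Section ProjectiveSpace.
Variables (R : realType) (n : nat).
Local Notation C := (CC R).
Local Notation P := (mpoly n.+1 C).
Local Notation K := {fraction P}.

(* P^n is handled through homogeneous coordinates: a point of P^n is a nonzero
   vector of C^(n+1) up to scaling, and subsets of P^n are represented by
   scaling-invariant sets of nonzero vectors. *)
Definition hpoint : Type := 'rV[C]_n.+1.

Definition evalp (x : 'rV[C]_n.+1) (p : P) : C := meval (fun i => x 0 i) p.

(* The radial (Euler) vector field, sum_i x_i d/dx_i. *)
Definition radial (i : 'I_n.+1) : P := mpolyX C (mnm1 i).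

(* p \in H^0(P^n, O(m)) *)
Definition O_section (m : int) (p : P) : Prop :=
  match m with
  | Posz d => p \is ishomog1 d mdeg
  | Negz _ => p = 0
  end.

(* a \in H^0(D(f), O(m)), where D(f) = {f != 0} and f is homogeneous of
   degree e: homogeneous fractions of degree m with a power of f as
   denominator. *)
Definition O_section_on (f : P) (e : nat) (m : int) (a : K) : Prop :=
  exists (N : nat) (p : P),
    O_section ((N * e)%N%:Z + m) p /\ a = tofrac p / tofrac f ^+ N.

(* A differential k-form on C^(n+1) with coefficients in A is given by its
   values on the coordinate fields, (s_1, ..., s_k) |->
   omega (d/dx_(s_1), ..., d/dx_(s_k)), extended by 0 to the sequences of
   length different from k. *)
Definition diff_form (A : Type) : Type := seq 'I_n.+1 -> A.

(* Antisymmetry under adjacent transpositions; this is alternation, since the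
   coefficient rings are torsion-free. *)
Definition is_kform (A : pzRingType) (k : nat) (w : diff_form A) : Prop :=
  (forall s, size s <> k -> w s = 0) /\
  (forall s1 i j s2, w (s1 ++ [:: i, j & s2]) = - w (s1 ++ [:: j, i & s2])).

(* The interior product i_v w. *)
Definition contract (A : pzRingType) (v : 'I_n.+1 -> A) (w : diff_form A) :
    diff_form A :=
  fun s => \sum_(i < n.+1) v i * w (i :: s).

Definition eval_form (x : 'rV[C]_n.+1) (w : diff_form P) : diff_form C :=
  fun s => evalp x (w s).

(* w \in H^0(P^n, Omega^k(l)): by the Euler sequence, these are the polynomial
   k-forms on C^(n+1) whose coefficients are homogeneous of degree l - k and
   that are annihilated by the radial field. *)
Definition Omega_section (k : nat) (l : int) (w : diff_form P) : Prop :=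
  [/\ is_kform k w,
      forall s, O_section (l - k%:Z) (w s)
    & forall s, contract radial w s = 0].

Definition pfaff_system (k : nat) (l : int) (w : diff_form P) : Prop :=
  [/\ (0 < k < n)%N, Omega_section k l w & exists s, w s <> 0].

Definition pfaff_degree (k : nat) (l : int) : int := l - k%:Z - 1.

Definition pfaff_sing (w : diff_form P) : set hpoint :=
  [set x | x != 0 /\ forall s, evalp x (w s) = 0].

Definition zariski_closed (Z : set hpoint) : Prop :=
  exists F : set P, (forall p, F p -> exists d : nat, p \is ishomog1 d mdeg) /\
    Z = [set x | x != 0 /\ forall p, F p -> evalp x p = 0].

Definition zariski_irreducible (Z : set hpoint) : Prop :=
  [/\ zariski_closed Z, Z !=set0 &
      forall A B, zariski_closed A -> zariski_closed B ->
        Z `<=` A `|` B -> Z `<=` A \/ Z `<=` B].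

(* The codimension of Z is the infimum, over the irreducible closed subsets Y
   of Z, of the lengths of the maximal chains of irreducible closed subsets of
   P^n starting at Y. *)
Definition codim_ge (c : nat) (Z : set hpoint) : Prop :=
  forall Y, zariski_irreducible Y -> Y `<=` Z ->
    exists chain : nat -> set hpoint,
      [/\ chain 0%N = Y,
          forall i, (i <= c)%N -> zariski_irreducible (chain i)
        & forall i, (i < c)%N -> chain i `<` chain i.+1].

(* Near every point outside the singular set, w is the wedge product of k
   holomorphic 1-forms eta_1, ..., eta_k, that is
   w (d/dx_(s_1), ..., d/dx_(s_k)) = det (eta_a (d/dx_(s_b))).
   The neighbourhood is taken in the cone C^(n+1) \ 0; pulling back along local
   sections of the cone, or along the projection to P^n, this is the same as
   decomposability of the corresponding twisted form on P^n. *)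
Definition locally_decomposable (k : nat) (w : diff_form P) : Prop :=
  forall x : 'rV[C]_n.+1, x != 0 -> ~ pfaff_sing w x ->
    exists eta : 'I_k -> 'I_n.+1 -> 'rV[C]_n.+1 -> C,
      \forall y \near x,
        (forall a i, differentiable (eta a i) y) /\
        (forall s, size s = k ->
           evalp y (w s) =
           \det (\matrix_(a < k, b < k) eta a (nth ord0 s b) y)).

Definition hol_distribution (k : nat) (l : int) (w : diff_form P) : Prop :=
  [/\ pfaff_system k l w,
      locally_decomposable k w,
      codim_ge 2 (pfaff_sing w)
    & pfaff_sing w !=set0].

(* By the Euler sequence, a section of T_(P^n)(d - 1) is a vector field on
   C^(n+1) with homogeneous coefficients of degree d, modulo multiples of the
   radial field; it vanishes at x when its value is proportional to x. *)
Definition vfield : Type := 'I_n.+1 -> P.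

Definition vfield_sing (X : vfield) : set hpoint :=
  [set x | x != 0 /\ exists c : C, forall i, evalp x (X i) = c * x 0 i].

(* One-dimensional foliation of degree d, given by a nonzero section. *)
Definition foliation (d : int) (X : vfield) : Prop :=
  (forall i, O_section d (X i)) /\
  (exists x : hpoint, x != 0 /\ ~ vfield_sing X x).

Definition isolated_singularities (X : vfield) : Prop :=
  forall x : 'rV[C]_n.+1, vfield_sing X x ->
    \forall y \near x, vfield_sing X y -> exists c : C, y = c *: x.

Definition tangent_to (X : vfield) (w : diff_form P) : Prop :=
  forall s, contract X w s = 0.

(* v represents a section over D(f) of the tangent sheaf Ker(w) of T_(P^n):
   a vector field, homogeneous of degree 1, with i_v w = 0. *)
Definition tangent_section_on (w : diff_form P) (f : P) (e : nat)
    (v : 'I_n.+1 -> K) : Prop :=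
  (forall j, O_section_on f e 1 (v j)) /\
  (forall s, contract v (fun t => tofrac (w t)) s = 0).

(* Ker(w) is isomorphic to the sum of the line bundles O(1 - d_i). A morphism
   O(1 - d_i) -> Ker(w) is a section Y_i of Ker(w)(d_i - 1); the morphism
   (a_i) |-> sum_i a_i Y_i is an isomorphism when it is bijective on sections
   over each open set D(f), sections of T_(P^n) being taken modulo the radial
   field. *)
Definition tangent_sheaf_split (w : diff_form P) (r : nat) (d : 'I_r -> int) :
    Prop :=
  exists Y : 'I_r -> vfield,
    [/\ forall i j, O_section (d i) (Y i j),
        forall i, tangent_to (Y i) w
      & forall (f : P) (e : nat), f != 0 -> f \is ishomog1 e mdeg ->
          (forall v, tangent_section_on w f e v ->
             exists (a : 'I_r -> K) (b : K),
               [/\ forall i, O_section_on f e (1 - d i) (a i),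
                   O_section_on f e 0 b
                 & forall j, v j = \sum_(i < r) a i * tofrac (Y i j)
                                   + b * tofrac (radial j)]) /\
          (forall (a : 'I_r -> K) (b : K),
             (forall i, O_section_on f e (1 - d i) (a i)) ->
             O_section_on f e 0 b ->
             (forall j, \sum_(i < r) a i * tofrac (Y i j)
                        = b * tofrac (radial j)) ->
             forall i, a i = 0)].

(* The Pfaff system wG of codimension q leaves the distribution wD of
   codimension k invariant. *)
Definition leaves_invariant (q : nat) (wG : diff_form P) (k : nat)
    (wD : diff_form P) : Prop :=
  (q < k)%N /\
  forall x : hpoint, x != 0 -> ~ pfaff_sing wD x -> ~ pfaff_sing wG x ->
    forall v : 'I_n.+1 -> C,
      (forall s, contract v (eval_form x wD) s = 0) ->
      forall s, contract v (eval_form x wG) s = 0.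

End ProjectiveSpace.

(* Main.v *)
Require Import Defs.
From HB Require Import structures.
From mathcomp Require Import all_boot all_order all_algebra.
From mathcomp Require Import generic_quotient fraction complex.
From mathcomp Require Import -(notations) mpoly.
From mathcomp Require Import all_classical all_reals all_analysis.
From mathcomp Require Import ring lra zify.
Require Import Defs.
Set Implicit Arguments.
Unset Strict Implicit.
Unset Printing Implicit Defensive.
Import Order.TTheory GRing.Theory Num.Theory.
Import numFieldNormedType.Exports.
Local Open Scope classical_set_scope.
Local Open Scope ring_scope.

(** The degree of the distribution is the sum of the degrees of the summands of
its tangent sheaf, and each summand has degree at most that of the Pfaff system.
Both facts are proved in homogeneous coordinates, on the cone C^(n+1).

One foliation: [foliation_degree_lt].  Let X be homogeneous of degree d with
isolated singularities, and let w be a nonzero form of positive degree, with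
coefficients of degree e, that is annihilated by X and by the radial field.
Then d < e; for the Pfaff system G this reads d <= deg G.  There are only
countably many singular lines, so some multiple of the radial field can be
subtracted from X to obtain a field X' that vanishes only at the origin
([exists_nonvanishing_shift]).  By the Nullstellensatz the components of X'
generate an ideal that contains a power of each variable, and this forces
their Koszul complex to be exact ([koszul_exact]); hence w = i_X' eta with eta
of degree e - d.  So d <= e, and when d = e the form eta is constant.  Its
contraction with the radial field is again annihilated by X' and has degree 1;
for d > 1 it vanishes by the same exactness, so that eta = 0.  For d = 1 the
field is a matrix whose eigenspaces are lines, and it is self-adjoint for the
skew forms obtained from eta; such a skew form is zero
([skew_selfadjoint_eq0]).

The distribution: [split_tangent_sheaf_form].  The radial field and the fields
Y_i that generate the tangent sheaf are independent over the field of rational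
functions, and decomposability shows that they span the kernel of the form wD.
So their number is n + 1 - k, and wD is proportional to the form Phi obtained
by contracting the volume form with all of them; the coefficients of Phi have
degree 1 + sum d_i.  If wD had larger degree than Phi, its coefficients would
share a factor and wD would vanish on a hypersurface, against the assumption
on the codimension of the singular set ([codim_common_factor]).  Unique
factorization of polynomials in several variables is replaced here by
restriction to the generic line with a fixed direction, where the polynomials
have one variable, with coefficients in the field of rational functions: an
irreducible factor pi on that line cuts out an irreducible closed set, and a
dependence argument shows that the only larger irreducible closed set is the
whole space. *)

(** * Alternating forms, contraction and exterior product *)

Section Forms.
Variables (n : nat) (A : comNzRingType).
Local Notation I := 'I_n.+1.
Local Notation form := (diff_form n A).
Implicit Types (w : form) (v h : I -> A) (s : seq I).

Definition alternating w :=
  forall s1 i j s2, w (s1 ++ [:: i, j & s2]) = - w (s1 ++ [:: j, i & s2]).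

Lemma contract_kform k v w : is_kform k.+1 w -> is_kform k (contract v w).
Proof.
case=> w0 wA; split=> [s ns|s1 a b s2].
  by rewrite /contract big1 // => i _; rewrite w0 ?mulr0 //= => -[].
rewrite /contract -sumrN; apply: eq_bigr => i _.
by rewrite -!cat_cons wA mulrN.
Qed.

Lemma contract_anticomm u v w : alternating w ->
  contract u (contract v w) = fun s => - contract v (contract u w) s.
Proof.
move=> wA; apply/funext => s; rewrite /contract.
under eq_bigr do rewrite mulr_sumr.
rewrite exchange_big -sumrN; apply: eq_bigr => i _.
rewrite mulr_sumr -sumrN; apply: eq_bigr => j _.
by rewrite -[[:: i, j & s]]/([::] ++ [:: i, j & s]) wA /=; ring.
Qed.

Lemma contractB u w w' :
  contract u (fun s => w s - w' s) = fun s => contract u w s - contract u w' s.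
Proof.
apply/funext => s; rewrite /contract -sumrB; apply: eq_bigr => i _.
by rewrite mulrBr.
Qed.

Lemma contractZ u a w :
  contract u (fun s => a * w s) = fun s => a * contract u w s.
Proof.
apply/funext => s; rewrite /contract mulr_sumr; apply: eq_bigr => i _; ring.
Qed.

Lemma contract0 u : contract u (fun=> 0 : A) = (fun=> 0) :> form.
Proof. by apply/funext => s; rewrite /contract big1 // => i _; rewrite mulr0. Qed.

(** The exterior product of the 1-form h with w, expanded along its first
argument. *)
Fixpoint wedge h w s : A :=
  if s is i :: s' then h i * w s' - wedge h (fun t => w (i :: t)) s' else 0.

Lemma wedge0 h s : wedge h (fun=> 0) s = 0.
Proof. by elim: s => //= i s ->; rewrite mulr0 subr0. Qed.

Lemma wedgeN h w s : wedge h (fun t => - w t) s = - wedge h w s.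
Proof. by elim: s w => [|i s IH] w /=; [rewrite oppr0|rewrite IH mulrN opprD]. Qed.

Lemma wedge_sum h v (W : I -> form) s :
  wedge h (fun t => \sum_i v i * W i t) s = \sum_i v i * wedge h (W i) s.
Proof.
elim: s W => [|j s IH] W /=; first by rewrite big1 // => i _; rewrite mulr0.
rewrite IH mulr_sumr -sumrB; apply: eq_bigr => i _; ring.
Qed.

(** Contraction is an antiderivation.  This one formula yields the Koszul
homotopy below and the dual frames used to compare forms of top degree. *)
Lemma contract_wedge v h w s :
  contract v (wedge h w) s = (\sum_i v i * h i) * w s - wedge h (contract v w) s.
Proof.
rewrite wedge_sum mulr_suml -sumrB; apply: eq_bigr => i _ /=; ring.
Qed.

Lemma wedge_kform k h w : is_kform k w -> is_kform k.+1 (wedge h w).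
Proof.
case=> w0 wA; split.
  move=> s; elim: s k w w0 {wA} => [|i s IH] k w w0 //= ns.
  have nsk : size s <> k by move=> e; apply: ns; rewrite e.
  rewrite w0 // mulr0 sub0r.
  case: k w0 nsk {ns} => [|k] w0 nsk.
    rewrite (_ : (fun t => w (i :: t)) = fun=> 0) ?wedge0 ?oppr0 //.
    by apply/funext => t; rewrite w0.
  by rewrite (IH k) ?oppr0 // => t nt; apply: w0 => /= -[].
move=> s1 i j s2; elim: s1 w wA {w0} => [|a s1 IH] w wA /=.
  rewrite [X in _ - (_ - X)](_ : _ = - wedge h (fun t => w [:: j, i & t]) s2); first ring.
  by rewrite -wedgeN; congr wedge; apply/funext => t; rewrite (wA [::]).
rewrite wA IH; first ring.
by move=> t1 b c t2; rewrite -!cat_cons wA.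
Qed.

(* antisymmetry makes a form vanish on repeated arguments only without 2-torsion *)
Hypothesis A2 : forall a : A, a + a = 0 -> a = 0.

Lemma alternating_move w p x s t : alternating w ->
  w (p ++ x :: s ++ t) = 0 -> w (p ++ s ++ x :: t) = 0.
Proof.
move=> wA; elim: s p => [|y s IH] p //= E.
by rewrite -cat_rcons IH // cat_rcons wA E oppr0.
Qed.

Lemma alternating_perm w s t : alternating w ->
  perm_eq s t -> w s = 0 -> w t = 0.
Proof.
move=> wA; suff H p : perm_eq s t -> w (p ++ s) = 0 -> w (p ++ t) = 0 by exact: (H [::]).
elim: s t p => [|x s IH] t p; first by rewrite perm_sym => /perm_nilP ->.
move=> pst; have xt : x \in t by rewrite -(perm_mem pst) mem_head.
case/splitPr: xt pst => t1 t2; rewrite perm_sym perm_catC /= perm_cons => pst E.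
apply: alternating_move => //; rewrite -cat_rcons; apply: IH.
  by rewrite perm_sym perm_catC.
by rewrite cat_rcons.
Qed.

Lemma alternating_nuniq w s : alternating w -> ~~ uniq s -> w s = 0.
Proof.
move=> wA; move=> /(uniqPn ord0) [i [j [ij js e]]].
have is_ : (i < size s)%N by apply: ltn_trans js.
set x := nth ord0 s i in e.
have xs : x \in s by apply: mem_nth.
suff [s' ps] : exists s', perm_eq [:: x, x & s'] s.
  apply: (alternating_perm wA ps); apply: A2.
  by rewrite {1}(wA [::]) addNr.
exists (behead (behead [seq y <- s | y == x]) ++ [seq y <- s | y != x]).
have c2 : (1 < count_mem x s)%N.
  rewrite -(cat_take_drop j s) count_cat.
  have h1 : (0 < count_mem x (take j s))%N.
    rewrite -has_count has_pred1; apply/(nthP ord0); exists i; last by rewrite nth_take.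
    by rewrite size_takel // ltnW.
  have h2 : (0 < count_mem x (drop j s))%N.
    by rewrite -has_count has_pred1 (drop_nth ord0) // -e mem_head.
  lia.
have -> : [:: x, x & behead (behead [seq y <- s | y == x]) ++ [seq y <- s | y != x]]
   = [seq y <- s | y == x] ++ [seq y <- s | y != x].
  have : all (pred1 x) [seq y <- s | y == x] by apply: filter_all.
  have : (1 < size [seq y <- s | y == x])%N by rewrite size_filter.
  by case: [seq y <- s | y == x] => [|a [|b r]] //= _ /and3P[/eqP-> /eqP-> _].
exact: permEl (perm_filterC _ _).
Qed.

Lemma kform_gt k w s : is_kform k w -> (n.+1 < k)%N -> w s = 0.
Proof.
move=> [w0 wA] kn; have [/eqP sk|/eqP sk] := boolP (size s == k); last exact: w0.
apply: alternating_nuniq => //; apply/negP => us.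
have := uniq_leq_size us (fun x _ => mem_enum I x).
by rewrite size_enum_ord sk leqNgt kn.
Qed.

(** All lists of n + 1 distinct indices are permutations of each other, so the
forms of top degree make up a module of rank one. *)
Lemma kform_top w s : is_kform n.+1 w -> w (enum I) = 0 -> w s = 0.
Proof.
move=> [w0 wA] e; have [/eqP sk|/eqP sk] := boolP (size s == n.+1); last exact: w0.
have [us|nus] := boolP (uniq s); last exact: alternating_nuniq.
apply: alternating_perm e => //; apply: uniq_perm; rewrite ?enum_uniq //.
move=> x.
have sz : (size (enum I) <= size s)%N by rewrite size_enum_ord sk.
by have [_ ->] := uniq_min_size us (fun x _ => mem_enum I x) sz.
Qed.

Lemma contractK u w : alternating w -> contract u (contract u w) = fun=> 0.
Proof.
move=> wA; apply/funext => s; apply: A2.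
by rewrite {1}(contract_anticomm _ _ wA) addNr.
Qed.

End Forms.

(** * Exactness of the Koszul complex *)

Section Koszul.
Variables (F : numFieldType) (n : nat).
Local Notation S := (mpoly n.+1 F).
Local Notation I := 'I_n.+1.

Lemma mpoly_double_eq0 (p : S) : p + p = 0 -> p = 0.
Proof.
move=> e; apply/mpolyP => m; apply/eqP; rewrite mcoeff0.
have /eqP : mcoeff m (p + p) = 0 by rewrite e mcoeff0.
by rewrite mcoeffD -mulr2n mulrn_eq0.
Qed.

Lemma frac_double_eq0 (k : {fraction S}) : k + k = 0 -> k = 0.
Proof.
have -> : k + k = k * tofrac 2%:R by rewrite rmorph_nat; ring.
move/eqP; rewrite mulf_eq0 => /orP[/eqP//|].
rewrite tofrac_eq0 -mpolyC_nat mpolyC_eq0; by rewrite pnatr_eq0.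
Qed.

Variable N : nat.

Local Notation XN j := (mpolyX F (mnm_muln (mnm1 j) N)).

(** The ideal generated by the N-th powers of the first j variables, described
by the monomials that it leaves out. *)
Definition trunc_ideal (j : nat) (p : S) :=
  forall m : multinom n.+1, (forall i : I, (i < j)%N -> (m i < N)%N) -> mcoeff m p = 0.

Lemma trunc_idealD j p q : trunc_ideal j p -> trunc_ideal j q -> trunc_ideal j (p + q).
Proof. by move=> hp hq m hm; rewrite mcoeffD hp // hq // addr0. Qed.

Lemma trunc_ideal0 j : trunc_ideal j 0.
Proof. by move=> m _; rewrite mcoeff0. Qed.

Lemma trunc_idealM j a p : trunc_ideal j p -> trunc_ideal j (a * p).
Proof.
move=> hp m hm; rewrite mcoeffM big1 // => -[m1 m2] /eqP /= e.
rewrite (hp m2) ?mulr0 // => i ij; apply: leq_ltn_trans (hm i ij).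
by have -> : m i = (m1 i + m2 i)%N; [rewrite -mnmDE -e | exact: leq_addl].
Qed.

Lemma trunc_idealN j p : trunc_ideal j p -> trunc_ideal j (- p).
Proof. by move=> /(trunc_idealM (-1)); rewrite mulN1r. Qed.

Lemma trunc_idealB j p q : trunc_ideal j p -> trunc_ideal j q -> trunc_ideal j (p - q).
Proof. by move=> hp /trunc_idealN; exact: trunc_idealD. Qed.

Lemma trunc_ideal_sum j (v : I -> S) (u : I -> S) :
  (forall i, trunc_ideal j (u i)) -> trunc_ideal j (\sum_i v i * u i).
Proof.
move=> h; elim/big_rec: _ => [|i p _ hp]; first exact: trunc_ideal0.
by apply: trunc_idealD => //; apply: trunc_idealM.
Qed.

Lemma trunc_idealS j p : trunc_ideal j p -> trunc_ideal j.+1 p.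
Proof. by move=> hp m hm; apply: hp => i ij; apply: hm; rewrite ltnS ltnW. Qed.

Lemma trunc_ideal_wedge j (h : I -> S) (w : diff_form n S) s :
  (forall t, trunc_ideal j (w t)) -> trunc_ideal j (wedge h w s).
Proof.
elim: s w => [|i s IH] w hw /=; first exact: trunc_ideal0.
by apply: trunc_idealB; [apply: trunc_idealM | apply: IH].
Qed.

Lemma trunc_ideal_XN (j : I) a : trunc_ideal j.+1 (XN j * a).
Proof.
move=> m hm; rewrite mulrC; apply/eqP; rewrite mcoeff_eq0; apply/negP.
rewrite (perm_mem (msuppMX _ _)) => /mapP[m' _ e].
have := hm j (ltnSn j).
by rewrite e mnmDE mulmnE mnm1E eqxx mul1n ltnNge leq_addr.
Qed.

(** The powers x_0^N, ..., x_n^N form a regular sequence. *)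
Lemma trunc_ideal_XNI (j : I) a : trunc_ideal j (XN j * a) -> trunc_ideal j a.
Proof.
move=> h m hm; rewrite -(mcoeffMX _ (mnm_muln (mnm1 j) N)) mulrC h // => i ij.
rewrite mnmDE mulmnE mnm1E; case: eqP => [e|_]; last by rewrite mul0n add0n hm.
by rewrite e ltnn in ij.
Qed.

(** The quotient of p by x_j^N, monomial by monomial.  It depends linearly on p,
so it maps alternating forms to alternating forms. *)
Definition shift_down (j : I) (p : S) : S :=
  \sum_(m : bmultinom n.+1 (msize p))
     mcoeff (mnm_add (mnm_muln (mnm1 j) N) m) p *: mpolyX F m.

Lemma mcoeff_shift_down j p m :
  mcoeff m (shift_down j p) = mcoeff (mnm_add (mnm_muln (mnm1 j) N) m) p.
Proof.
have [lt|le] := ltnP (mdeg m) (msize p).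
  exact: (mcoeff_mpoly (fun m => mcoeff (mnm_add (mnm_muln (mnm1 j) N) m) p)).
rewrite [RHS]memN_msupp_eq0; last first.
  apply: msize_mdeg_ge; rewrite mdegD; apply: leq_trans le _; exact: leq_addl.
rewrite raddf_sum big1 //= => m' _; rewrite mcoeffZ mcoeffX.
case: eqP => [e|]; rewrite ?mulr0 //.
by have := bmdeg m'; rewrite e ltnNge le.
Qed.

Lemma shift_downN j p : shift_down j (- p) = - shift_down j p.
Proof. by apply/mpolyP => m; rewrite mcoeffN !mcoeff_shift_down mcoeffN. Qed.

Lemma shift_down0 j : shift_down j 0 = 0.
Proof. by apply/mpolyP => m; rewrite mcoeff_shift_down !mcoeff0. Qed.

Lemma trunc_ideal_shift_down (j : I) p :
  trunc_ideal j.+1 p -> trunc_ideal j (p - XN j * shift_down j p).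
Proof.
move=> hp m hm; rewrite mcoeffB mulrC.
have [le|lt] := leqP N (m j).
  have em : m = mnm_add (mnm_muln (mnm1 j) N) (mnm_sub m (mnm_muln (mnm1 j) N)).
    apply/mnmP => i; rewrite mnmDE mnmBE mulmnE mnm1E.
    by case: eqP => [<-|_]; rewrite ?mul1n ?subnKC // mul0n subn0.
  by rewrite {2}em mcoeffMX mcoeff_shift_down -em subrr.
rewrite hp => [|i]; last first.
  rewrite ltnS leq_eqVlt => /orP[/eqP/val_inj -> //|]; exact: hm.
rewrite memN_msupp_eq0 ?subr0 //.
rewrite (perm_mem (msuppMX _ _)); apply/negP => /mapP[m' _ e].
by move: lt; rewrite e mnmDE mulmnE mnm1E eqxx mul1n ltnNge leq_addr.
Qed.

Variables (f : I -> S) (h : I -> I -> S).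
Hypothesis hf : forall j, XN j = \sum_i f i * h j i.

(** The Koszul homology of f in degree p vanishes modulo the first j powers as
soon as p > j.  This is descending induction on j.  For j = n + 1 there are no
nonzero forms of degree p.  For the step, g = x_j^N belongs to the ideal of f
and thus kills the homology, by the homotopy given by the exterior product
with h_j; since g is regular modulo the earlier powers, the vanishing modulo g
in degree p + 1 implies the vanishing in degree p. *)
Lemma koszul_mod d j p w : (j + d = n.+1)%N -> (j < p)%N -> is_kform p w ->
  (forall s, trunc_ideal j (contract f w s)) ->
  exists eta, is_kform p.+1 eta /\
    forall s, trunc_ideal j (w s - contract f eta s).
Proof.
elim: d j p w => [|d IH] j p w jd jp kw hw.
  exists (fun=> 0); split; first by split=> // *; rewrite oppr0.
  move=> s; rewrite (kform_gt mpoly_double_eq0 s kw); last by rewrite -jd addn0.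
  by rewrite contract0 subr0; apply: trunc_ideal0.
have jn : (j < n.+1)%N by rewrite -jd addnS ltnS leq_addr.
pose jo := Ordinal jn.
have kt : is_kform p.+1 (wedge (h jo) w) by apply: wedge_kform.
have et s : contract f (wedge (h jo) w) s =
            XN jo * w s - wedge (h jo) (contract f w) s.
  by rewrite contract_wedge -hf.
have [||s|e' [ke' he']] := IH j.+1 p.+1 (wedge (h jo) w) _ _ kt.
- by rewrite addSnnS.
- by [].
- rewrite et; apply: trunc_idealB; first exact: (@trunc_ideal_XN jo).
  by apply: trunc_idealS; apply: trunc_ideal_wedge.
pose z s := shift_down jo (wedge (h jo) w s - contract f e' s).
have kz : is_kform p.+1 z.
  have [c0 cA] := contract_kform f ke'; have [t0 tA] := kt.
  split=> [s ns|s1 a b s2]; rewrite /z.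
    by rewrite c0 // t0 // subr0 shift_down0.
  by rewrite -shift_downN cA tA opprB opprK addrC.
exists z; split=> // s.
have : trunc_ideal j (contract f (fun s => wedge (h jo) w s - contract f e' s - XN jo * z s) s).
  by apply: trunc_ideal_sum => i; apply: (@trunc_ideal_shift_down jo); apply: he'.
rewrite !contractB et contractZ contractK; last by case: ke'.
  move=> H; apply: (@trunc_ideal_XNI jo).
  have := trunc_idealD H (trunc_ideal_wedge (h jo) s hw).
  suff -> : forall a b c d : S, a * b - d - 0 - a * c + d = a * (b - c) by [].
  by move=> *; ring.
exact: mpoly_double_eq0.
Qed.

(** Depth sensitivity of the Koszul complex: n + 1 polynomials whose ideal
contains a power of every variable behave as a regular sequence. *)
Theorem koszul_exact p w : is_kform p.+1 w -> contract f w = (fun=> 0) ->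
  exists eta, is_kform p.+2 eta /\ w = contract f eta.
Proof.
move=> kw w0; have [|s|eta [ke he]] := @koszul_mod n.+1 0 p.+1 w (add0n _) _ kw.
- by [].
- by rewrite w0; apply: trunc_ideal0.
exists eta; split=> //; apply/funext => s; apply/eqP; rewrite -subr_eq0; apply/eqP.
by apply/mpolyP => m; rewrite he // mcoeff0.
Qed.

End Koszul.

(** * The Nullstellensatz over the complex numbers *)

(** The uncountability of the complex numbers in the form in which it is used,
for the Nullstellensatz and for the choice of a generic multiple of the radial
field. *)
Lemma infinite_fiber (R : realType) (T : countType) (code : CC R -> T) :
  exists t, infinite_set [set c | code c = t].
Proof.
apply: contrapT => /forallNP fin.
have {}fin t : finite_set [set c | code c = t] by apply: contrapT; apply: fin.
pose f (x : R) : CC R := (x%:C)%C.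
have finj : injective f by move=> x y [].
have cR : countable [set: R].
  have -> : [set: R] = \bigcup_(t in [set: T]) [set x | code (f x) = t].
    by apply/seteqP; split=> // x _; exists (code (f x)).
  apply: bigcup_countable => [|t _]; first exact: countableP.
  apply: finite_set_countable.
  have -> : [set x | code (f x) = t] = f @^-1` [set c | code c = t] by [].
  by apply: finite_preimage => // x y _ _ /finj.
have := countable_lebesgue_measure0 cR.
have := @lebesgue_measure_itv R `]-oo, +oo[%R.
by rewrite set_itvNyy /= => ->.
Qed.

Section Ideals.
Variables (S : comNzRingType).

Record is_ideal (J : S -> Prop) : Prop := IsIdeal {
  ideal0 : J 0;
  idealD : forall a b, J a -> J b -> J (a + b);
  idealM : forall a b, J b -> J (a * b) }.

Lemma idealN J a : is_ideal J -> J a -> J (- a).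
Proof. by move=> iJ Ja; rewrite -mulN1r; apply: idealM. Qed.

Lemma idealB J a b : is_ideal J -> J a -> J b -> J (a - b).
Proof. by move=> iJ Ja Jb; apply: idealD => //; apply: idealN. Qed.

Lemma ideal_sum J (T : Type) (r : seq T) (F : T -> S) :
  is_ideal J -> (forall t, J (F t)) -> J (\sum_(t <- r) F t).
Proof.
move=> iJ h; elim/big_rec: _ => [|i x _ Jx]; first exact: ideal0.
exact: idealD.
Qed.

Definition adjoin (J : S -> Prop) (y : S) (a : S) : Prop := exists u, J (a - u * y).

Lemma adjoin_ideal J y : is_ideal J -> is_ideal (adjoin J y).
Proof.
move=> iJ; split=> [|a b [u hu] [v hv]|a b [u hu]].
- by exists 0; rewrite mul0r subr0; apply: ideal0.
- exists (u + v); rewrite (_ : _ - _ = a - u * y + (b - v * y)); first exact: idealD.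
  by ring.
- exists (a * u); rewrite -mulrA -mulrBr; exact: idealM.
Qed.

Lemma sub_adjoin J y a : J a -> adjoin J y a.
Proof. by move=> Ja; exists 0; rewrite mul0r subr0. Qed.

Lemma mem_adjoin J y : is_ideal J -> adjoin J y y.
Proof. by move=> iJ; exists 1; rewrite mul1r subrr; apply: ideal0. Qed.

(** Properness of J after inverting h; with h itself in place of an extra
variable, the strong Nullstellensatz is obtained directly. *)
Definition avoids (J : S -> Prop) (h : S) := forall N, ~ J (h ^+ N).

End Ideals.

Section Nullstellensatz.
Variables (R : realType) (n : nat).
Local Notation C := (CC R).
Local Notation S := (mpoly n.+1 C).
Local Notation I := 'I_n.+1.

(** The polynomials of bounded degree make up a space of finite dimension. *)
Lemma lin_dep_bounded D (M := #|{: bmultinom n.+1 D}|) (u : 'I_M.+1 -> S) :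
  (forall k, (msize (u k) <= D)%N) ->
  exists2 a : 'rV[C]_M.+1, a != 0 & \sum_k a 0 k *: u k = 0.
Proof.
move=> hu; pose A : 'M[C]_(M.+1, M) := \matrix_(k, m) mcoeff (val (enum_val m)) (u k).
have : kermx A != 0.
  by rewrite kermx_eq0 /row_free neq_ltn ltnS rank_leq_col.
case/rowV0Pn => a /sub_kermxP aA a0; exists a => //.
apply/mpolyP => m; rewrite mcoeff0 raddf_sum /=.
have [lt|le] := ltnP (mdeg m) D; last first.
  rewrite big1 // => k _; rewrite mcoeffZ memN_msupp_eq0 ?mulr0 //.
  by apply: msize_mdeg_ge; apply: leq_trans le.
have := congr1 (fun B : 'rV[C]_M => B 0 (enum_rank (BMultinom lt))) aA.
rewrite !mxE => e; rewrite -[RHS]e; apply: eq_bigr => k _.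
by rewrite mcoeffZ mxE enum_rankK.
Qed.

Local Notation evx x q := ((map_poly (@mpolyC n.+1 C) q).[x]).

(** If every x - c divides a power of h modulo J, then so does every nonzero
polynomial in x, since it splits into such factors. *)
Lemma avoids_poly_eval (J : S -> Prop) h (x : S) N (q : {poly C}) :
  is_ideal J -> (forall c : C, ~ avoids (adjoin J (x - mpolyC n.+1 c)) h) ->
  q != 0 -> J (h ^+ N * evx x q) -> exists N', J (h ^+ N').
Proof.
move=> iJ hJ q0; have [rs ->] := closed_field_poly_normal q.
rewrite -mul_polyC rmorphM /= hornerM map_polyC hornerC mulrCA.
move=> /(idealM iJ (mpolyC _ (lead_coef q)^-1)).
rewrite [X in J X]mulrA -mpolyCM mulVf ?lead_coef_eq0 // mul1r => {q q0}.
elim: rs N => [|z rs IH] N.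
  by rewrite big_nil rmorph1 hornerE mulr1; exists N.
rewrite big_cons rmorphM /= hornerM map_polyXsubC hornerXsubC => Jz.
have /existsNP[Nz /contrapT[u hu]] := hJ z.
apply: (IH (N + Nz)%N).
set P := evx x _ in Jz *.
have := idealD iJ (idealM iJ u Jz) (idealM iJ (h ^+ N * P) hu).
rewrite exprD; by congr J => /=; ring.
Qed.

(** One value c of the element x can be fixed without making J meet the powers
of h.  Otherwise each x - c has an inverse u_c modulo J, up to a power of h.
Uncountably many c share the same power and the same bound on the degree of
u_c, so some of these u_c are linearly dependent; clearing denominators in the
dependence gives a nonzero polynomial q with h^N q(x) in J. *)
Lemma avoids_adjoin (J : S -> Prop) h (x : S) : is_ideal J -> avoids J h ->
  exists c : C, avoids (adjoin J (x - mpolyC n.+1 c)) h.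
Proof.
move=> iJ aJ; apply: contrapT => /forallNP hJ.
have /choice[code hc] : forall c, exists Nu : nat * S,
    J (h ^+ Nu.1 - Nu.2 * (x - mpolyC n.+1 c)).
  by move=> c; have /existsNP[N /contrapT[u hu]] := hJ c; exists (N, u).
have [[N D] inf] := infinite_fiber (fun c => ((code c).1, msize (code c).2)).
pose M := #|{: bmultinom n.+1 D}|.
have [B BA sB] := infinite_set_fset M.+1 inf.
pose cs (k : 'I_M.+1) := nth 0 (finmap.enum_fset B) k.
have csB k : code (cs k) = (N, (code (cs k)).2) /\ msize (code (cs k)).2 = D.
  have : cs k \in finmap.enum_fset B by apply: mem_nth; apply: leq_trans sB.
  by move/(BA (cs k)) => /= [<- ->]; case: (code _).
have csI : injective cs.
  move=> k l /eqP; rewrite nth_uniq ?finmap.fset_uniq //; first by move/eqP/val_inj.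
    by apply: leq_trans sB.
  by apply: leq_trans sB.
pose u k := (code (cs k)).2.
have hu k : J (h ^+ N - u k * (x - mpolyC n.+1 (cs k))).
  by have := hc (cs k); rewrite (csB k).1.
have [k|a a0 au] := @lin_dep_bounded D u; first by rewrite (csB k).2.
(* the numerator of the linear dependence of the fractions h^N / (x - c_k) *)
pose q : {poly C} := \sum_k a 0 k *: \prod_(l | l != k) ('X - (cs l)%:P).
have q0 : q != 0.
  have /rV0Pn[k ak] := a0; apply/eqP => /(congr1 (fun p => p.[cs k])).
  rewrite horner0 horner_sum (bigD1 k) //= [X in _ + X]big1 ?addr0 => [|l lk].
    rewrite hornerZ horner_prod; apply/eqP; rewrite mulf_neq0 //.
    apply/prodf_neq0 => l lk; rewrite !hornerE subr_eq0.
    by apply: contraNneq lk => /csI ->.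
  rewrite hornerZ horner_prod (bigD1 k) 1?eq_sym //= hornerXsubC subrr.
  by rewrite mul0r mulr0.
have [N' JN] : exists N', J (h ^+ N'); last exact: (aJ N').
apply: (avoids_poly_eval (N := N) (q := q) iJ hJ q0).
pose P k := \prod_(l | l != k) (x - mpolyC n.+1 (cs l)).
have -> : evx x q = \sum_k a 0 k *: P k.
  rewrite rmorph_sum horner_sum; apply: eq_bigr => k _.
  rewrite -mul_polyC rmorphM /= map_polyC hornerM hornerC mul_mpolyC; congr (_ *: _).
  rewrite rmorph_prod horner_prod; apply: eq_bigr => l _.
  by rewrite /= map_polyXsubC hornerXsubC.
have -> : h ^+ N * (\sum_k a 0 k *: P k) =
   \sum_k (a 0 k *: P k) * (h ^+ N - u k * (x - mpolyC n.+1 (cs k)))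
   + (\prod_l (x - mpolyC n.+1 (cs l))) * (\sum_k a 0 k *: u k).
  rewrite !mulr_sumr -big_split /=; apply: eq_bigr => k _.
  rewrite (bigD1 k) //= -/(P k) -!mul_mpolyC; ring.
rewrite au mulr0 addr0; apply: ideal_sum => // k; exact: idealM.
Qed.

Lemma ideal_point (J : S -> Prop) (c : I -> C) : is_ideal J ->
  (forall i, J (mpolyX C (mnm1 i) - mpolyC n.+1 (c i))) ->
  forall p : S, J (p - mpolyC n.+1 (meval c p)).
Proof.
move=> iJ hc.
pose Q (p : S) := J (p - mpolyC n.+1 (meval c p)).
have QM a b : Q a -> Q b -> Q (a * b).
  rewrite /Q mevalM mpolyCM => Qa Qb.
  have := idealD iJ (idealM iJ b Qa) (idealM iJ (mpolyC n.+1 (meval c a)) Qb).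
  by congr J; ring.
have QC a : Q (mpolyC n.+1 a) by rewrite /Q mevalC subrr; apply: ideal0.
have QD a b : Q a -> Q b -> Q (a + b).
  rewrite /Q mevalD mpolyCD => Qa Qb; have := idealD iJ Qa Qb.
  by congr J; ring.
have QX i k : Q (mpolyX C (mnm1 i) ^+ k).
  elim: k => [|k IH]; first by rewrite expr0 -[1]/(mpolyC n.+1 1); apply: QC.
  by rewrite exprS; apply: QM => //; rewrite /Q mevalXU.
have Qm (m : multinom n.+1) : Q (mpolyX C m).
  rewrite mpolyXE_id; apply: big_ind => //.
  by rewrite -[1]/(mpolyC n.+1 1); apply: QC.
move=> p; rewrite -/(Q p) (mpolyE p); apply: big_ind => //.
  by rewrite -mpolyC0; apply: QC.
by move=> m _; rewrite -mul_mpolyC; apply: QM.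
Qed.

(** Fix the values of the variables one after the other; what remains is an
ideal modulo which every polynomial equals its value at a point. *)
Theorem nullstellensatz (J : S -> Prop) h : is_ideal J -> avoids J h ->
  exists c : 'rV[C]_n.+1, (forall p, J p -> evalp c p = 0) /\ evalp c h != 0.
Proof.
move=> iJ aJ.
have H (s : seq I) : exists (c : I -> C) (J' : S -> Prop),
    [/\ is_ideal J', avoids J' h, forall p, J p -> J' p &
     forall i, i \in s -> J' (mpolyX C (mnm1 i) - mpolyC n.+1 (c i))].
  elim: s => [|i s [c [J' [iJ' aJ' JJ' hs]]]]; first by exists (fun=> 0), J.
  have [ci ai] := avoids_adjoin (mpolyX C (mnm1 i)) iJ' aJ'.
  exists (fun j => if j == i then ci else c j), (adjoin J' (mpolyX C (mnm1 i) - mpolyC n.+1 ci)).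
  split=> // [|p /JJ'|j]; first exact: adjoin_ideal.
    exact: sub_adjoin.
  rewrite inE; case: eqP => [->|_] /= js; first exact: mem_adjoin.
  by apply: sub_adjoin; apply: hs.
have [c [J' [iJ' aJ' JJ' hc]]] := H (enum I).
have {}hc := ideal_point iJ' (fun i => hc i (mem_enum I i)).
exists (\row_i c i).
have ev p : evalp (\row_i c i) p = meval c p.
  by apply: meval_eq => i; rewrite mxE.
split=> [p /JJ' Jp|]; rewrite ev.
  apply/eqP/negPn/negP => pc; apply: (aJ' 0%N).
  have := idealM iJ' (mpolyC n.+1 (meval c p)^-1) (idealB iJ' Jp (hc p)).
  by rewrite opprB addrC subrK -mpolyCM mulVf.
apply/eqP => hc0; apply: (aJ' 1%N); have := hc h.
by rewrite hc0 mpolyC0 subr0 expr1.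
Qed.

Lemma mpoly_nonzero_point (p : S) : p != 0 -> exists c : 'rV[C]_n.+1, evalp c p != 0.
Proof.
move=> p0; have [||c [_ hc]] := @nullstellensatz (fun a => a = 0) p; last by exists c.
  by split=> // [a b -> ->|a b ->]; rewrite ?addr0 ?mulr0.
by move=> N /eqP; rewrite expf_eq0 (negbTE p0) andbF.
Qed.

End Nullstellensatz.

(** * Homogeneous polynomials and skew matrices *)

Section Homogeneous.
Variables (F : fieldType) (n : nat).
Local Notation S := (mpoly n.+1 F).
Local Notation I := 'I_n.+1.
Local Notation hom d p := (p \is ishomog1 d mdeg).
Local Notation pih := (@pihomog n.+1 F mdeg).

Lemma pihomogM_hom d e (p q : S) : hom d q ->
  pih e (q * p) = if (d <= e)%N then q * pih (e - d) p else 0.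
Proof.
move=> hq; rewrite {1}(@pihomog_partitionE _ _ mdeg (maxn (msize p) e.+1) p) ?leq_maxl //.
rewrite mulr_sumr raddf_sum /=.
have hk k : hom (d + k)%N (q * pih k p) by apply: dhomogM => //; apply: pihomogP.
case: leqP => [le|lt]; last first.
  by rewrite big1 // => k _; rewrite (pihomog_ne0 _ (hk k)) // gtn_eqF // ltn_addr.
have ltk : (e - d < maxn (msize p) e.+1)%N by rewrite leq_max [X in _ || X]ltnS leq_subr orbT.
rewrite (bigD1 (Ordinal ltk)) //= big1 ?addr0 => [|k nk].
  by have := hk (e - d)%N; rewrite subnKC // => /pihomog_dE.
rewrite (pihomog_ne0 _ (hk k)) //; apply: contraNneq nk => eq.
by apply/eqP/val_inj => /=; move: (nat_of_ord k) eq => k' <-; rewrite addKn.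
Qed.

Lemma hom0P (p : S) : hom 0%N p -> p = mpolyC n.+1 (mcoeff (@mnm0 n.+1) p).
Proof.
move=> hp; apply/mpolyP => m; rewrite mcoeffC.
case: eqP => [->|nm]; first by rewrite mulr1.
by rewrite mulr0 (dhomog_nemf_coeff hp) // mdeg_eq0; apply/eqP.
Qed.

Lemma hom1P (p : S) : hom 1%N p ->
  p = \sum_(l < n.+1) mcoeff (mnm1 l) p *: mpolyX F (mnm1 l).
Proof.
move=> hp; apply/mpolyP => m; rewrite raddf_sum /=.
have [/mdeg1P[i /eqP ->]|nm] := boolP (mdeg m == 1%N).
  rewrite (bigD1 i) //= mcoeffZ mcoeffXU eqxx mulr1 big1 ?addr0 // => j nj.
  by rewrite mcoeffZ mcoeffXU (negbTE nj) mulr0.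
rewrite (dhomog_nemf_coeff hp nm) big1 // => j _; rewrite mcoeffZ mcoeffX.
by case: eqP => [e|]; rewrite ?mulr0 //; move: nm; rewrite -e mdeg1.
Qed.

Lemma meval_hom d (p : S) (v : I -> F) c : hom d p ->
  meval (fun i => c * v i) p = c ^+ d * meval v p.
Proof.
move=> hp; rewrite !mevalE mulr_sumr; apply: eq_big_seq => m mp.
rewrite mulrCA; congr (_ * _); under eq_bigr do rewrite exprMn.
by rewrite big_split /= prodrXr -mdegE (dhomog_mf hp mp).
Qed.

End Homogeneous.

Section SkewMatrices.
Variables (F : closedFieldType) (m : nat).
Hypothesis F2 : forall a : F, a = - a -> a = 0.
Implicit Types (A M : 'M[F]_m.+1).

Lemma skew_rank_le1 M : M^T = - M -> (\rank M <= 1)%N -> M = 0.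
Proof.
move=> sk rk; have skE i j : M j i = - M i j.
  by have := congr1 (fun B : 'M[F]_m.+1 => B i j) sk; rewrite !mxE.
have diag i : M i i = 0 by apply: F2; rewrite -skE.
apply/eqP/negPn/negP => M0.
have /existsP[i ri] : [exists i, row i M != 0].
  apply: contraT => /existsPn h; case/negP: M0; apply/eqP/row_matrixP => i.
  by rewrite row0; apply/eqP/negPn.
have Mi : (M <= row i M)%MS.
  rewrite -(geq_leqif (mxrank_leqif_sup (row_sub i M))).
  by apply: leq_trans rk _; rewrite lt0n mxrank_eq0.
have /rV0Pn[k] := ri; rewrite mxE => ik.
have /sub_rVP[c ck] : (row k M <= row i M)%MS by apply: submx_trans (row_sub k M) Mi.
have ckE j : M k j = c * M i j.
  by have := congr1 (fun B : 'rV[F]_m.+1 => B 0 j) ck; rewrite !mxE.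
have /eqP := ckE k; rewrite diag eq_sym mulf_eq0 (negbTE ik) orbF => /eqP c0.
by move: ik; rewrite -[M i k]opprK -skE ckE c0 mul0r oppr0 eqxx.
Qed.

(** By the theorem of Cayley and Hamilton a product of factors A - z annihilates
M.  The factors can be removed one at a time: (A - z) M is again skew and A is
self-adjoint for it, so it is enough to treat (A - z) M = 0; then M has rank at
most one, since A - z has corank at most one, and a skew matrix of rank one is
zero. *)
Lemma skew_selfadjoint_eq0 A M :
  (forall lambda, (\rank (kermx (A - lambda%:M)) <= 1)%N) ->
  M^T = - M -> A *m M = M *m A^T -> M = 0.
Proof.
move=> hA.
suff H (s : seq F) M' : M'^T = - M' -> A *m M' = M' *m A^T ->
    (\prod_(z <- s) (A - z%:M)) *m M' = 0 -> M' = 0.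
  move=> sk ad; have [s es] := closed_field_poly_normal (char_poly A).
  apply: (H s) => //; have := Cayley_Hamilton A.
  have /monicP mon := char_poly_monic A; rewrite mon scale1r in es.
  rewrite es rmorph_prod /= => /(congr1 (mulmx^~ M)); rewrite mul0mx => <-.
  congr (_ *m _); apply: eq_bigr => z _.
  by rewrite rmorphB /= horner_mx_X horner_mx_C.
elim: s M' => [|z s IH] M' sk ad.
  by rewrite big_nil -[1]/(1%:M) mul1mx.
pose B := A - z%:M.
have comm : (\prod_(y <- s) (A - y%:M)) *m B = B *m (\prod_(y <- s) (A - y%:M)).
  have cs (X : 'M[F]_m.+1) y : GRing.comm X (y%:M) by apply: comm_mx_scalar.
  apply/esym; rewrite -!mulmxE; apply: commr_prod => y _.
  by apply: commrB => //; apply: commr_sym; apply: commrB.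
rewrite big_cons -mulmxE -comm -mulmxA => P0.
have ad' : B *m M' = M' *m B^T.
  by rewrite /B linearB /= tr_scalar_mx mulmxBl mulmxBr ad mul_scalar_mx mul_mx_scalar.
have sk' : (B *m M')^T = - (B *m M').
  by rewrite trmx_mul sk mulNmx ad'.
have /IH-/(_ _ P0) BM : A *m (B *m M') = (B *m M') *m A^T.
  rewrite ad' !mulmxA ad -!mulmxA; congr (_ *m _).
  by rewrite /B linearB /= tr_scalar_mx mulmxBl mulmxBr mul_scalar_mx mul_mx_scalar.
apply: skew_rank_le1 => //; have := mulmx0_rank_max (BM sk').
have := hA z; rewrite mxrank_ker -/B; have := rank_leq_row B; lia.
Qed.

End SkewMatrices.

(** * Isolated singularities *)

Local Notation Re := complex.Re.
Local Notation Im := complex.Im.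

Section Isolated.
Variables (R : realType) (n : nat).
Local Notation C := (CC R).
Local Notation S := (mpoly n.+1 C).
Local Notation I := 'I_n.+1.
Local Notation hom d p := (p \is ishomog1 d mdeg).

Lemma evalpZ d (p : S) (c : C) (x : 'rV[C]_n.+1) : hom d p ->
  evalp (c *: x) p = c ^+ d * evalp x p.
Proof.
by move=> /(meval_hom _ c) <-; apply: meval_eq => i; rewrite mxE.
Qed.

Lemma near_radius (x : 'rV[C]_n.+1) (P : set 'rV[C]_n.+1) : (\forall y \near x, P y) ->
  exists2 e : R, 0 < e & forall y : 'rV[C]_n.+1, (forall i, `|x 0 i - y 0 i| < (e%:C)%C) -> P y.
Proof.
move=> /nbhs_ballP[e /= e0 he].
have ee : e = ((Re e)%:C)%C by rewrite [LHS]complexE (ger0_Im (ltW e0)) mulr0 addr0.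
exists (Re e); first by rewrite -ltcR -ee.
move=> y hy; apply: he; split=> // i j; rewrite /ball /= (ord1 i) ee; exact: hy.
Qed.

Lemma floor_close (M : nat) (a b : R) :
  Num.floor (a * M.+1%:R) = Num.floor (b * M.+1%:R) -> `|a - b| < M.+1%:R^-1.
Proof.
move=> e; have M0 : (0 : R) < M.+1%:R by rewrite ltr0n.
rewrite -(ltr_pM2r M0) mulVf ?gt_eqF // -[X in _ * X]ger0_norm ?ltW // -normrM mulrBl.
have /andP[a1 a2] := floor_itv (a * M.+1%:R).
have /andP[b1 b2] := floor_itv (b * M.+1%:R).
move: a1 a2; rewrite e => a1 a2; rewrite rmorphD /= in b2 a2; rewrite ltr_norml.
apply/andP; split; lra.
Qed.

Lemma norm_le_ReIm (z : C) : `|z| <= ((`|Re z| + `|Im z|)%:C)%C.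
Proof.
have nC (r : R) : `|(r%:C)%C : C| = (`|r|%:C)%C.
  by rewrite normc_def /= expr0n addr0 sqrtr_sqr.
rewrite [in leLHS](complexE z) (le_trans (ler_normD _ _)) // normrM !nC rmorphD /=.
rewrite lerD2l (_ : `|'i%C| = 1) ?mul1r //.
by rewrite normc_def /= expr0n expr1n add0r sqrtr1.
Qed.

(** The singularities of a linear field are its eigenvectors.  If y were an
eigenvector for the same eigenvalue and not a multiple of x, the whole line
x + del y would consist of singularities arbitrarily close to x. *)
Lemma isolated_eigen (X : vfield R n) (lam : C) (x y : 'rV[C]_n.+1) (A : 'M[C]_n.+1) :
  isolated_singularities X -> (forall z i, evalp z (X i) = (z *m A) 0 i) ->
  x != 0 -> x *m A = lam *: x -> y *m A = lam *: y -> exists c, y = c *: x.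
Proof.
move=> isoX XA x0 xA yA.
have sing z : z != 0 -> z *m A = lam *: z -> vfield_sing X z.
  by move=> z0 zA; split=> //; exists lam => i; rewrite XA zA mxE.
have [e e0 he] := near_radius (isoX x (sing x x0 xA)).
pose b : R := \sum_(i < n.+1) (`|Re (y 0 i)| + `|Im (y 0 i)|).
have b0 : 0 <= b by apply: sumr_ge0 => i _; apply: addr_ge0.
have yb i : `|y 0 i| <= (b%:C)%C.
  apply: le_trans (norm_le_ReIm _) _; rewrite lecR /b (bigD1 i) //= lerDl.
  by apply: sumr_ge0 => j _; apply: addr_ge0.
pose del : R := e / (b + 1).
have del0 : 0 < del by rewrite divr_gt0 // ltr_wpDl.
have delC0 : ((del%:C)%C : C) != 0 by rewrite gt_eqF // ltcR.
pose z := x + (del%:C)%C *: y.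
have [z0|z0] := eqVneq z 0.
  exists (- (del%:C)%C^-1); apply: (scalerI delC0).
  by rewrite scalerA mulrN mulfV // scaleN1r; apply/eqP; rewrite -addr_eq0 addrC; apply/eqP.
have [c zc] : exists c : C, z = c *: x.
  apply: he => [i|]; last first.
    by apply: sing; rewrite // mulmxDl -scalemxAl xA yA scalerDr !scalerA mulrC.
  rewrite /z !mxE opprD addrA subrr add0r normrN normrM ger0_norm ?lecR ?ltW //.
  apply: le_lt_trans (ler_wpM2l _ (yb i)) _; first by rewrite lecR ltW.
  rewrite -rmorphM /= ltcR /del mulrAC ltr_pdivrMr ?ltr_wpDl // ltr_pM2l //.
  by rewrite ltrDl.
exists ((c - 1) / (del%:C)%C); apply: (scalerI delC0).
by rewrite scalerA mulrC divfK // scalerBl -zc scale1r /z addrC addKr.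
Qed.

(** The cell of x in the cubic grid of mesh 1/(M+1): countably many cells cover
all points at all scales. *)
Definition grid_code (M : nat) (x : 'rV[C]_n.+1) : {ffun I -> int * int} :=
  [ffun i => (Num.floor (Re (x 0 i) * M.+1%:R), Num.floor (Im (x 0 i) * M.+1%:R))].

Lemma grid_code_close M (x y : 'rV[C]_n.+1) : grid_code M x = grid_code M y ->
  forall i, `|x 0 i - y 0 i| < ((2 / M.+1%:R)%:C)%C.
Proof.
move=> /ffunP h i; have := h i; rewrite !ffunE => -[/floor_close h1 /floor_close h2].
apply: le_lt_trans (norm_le_ReIm _) _; rewrite ltcR.
have -> : Re (x 0 i - y 0 i) = Re (x 0 i) - Re (y 0 i) by case: (x 0 i) (y 0 i) => ? ? [].
have -> : Im (x 0 i - y 0 i) = Im (x 0 i) - Im (y 0 i) by case: (x 0 i) (y 0 i) => ? ? [].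
by rewrite mulr_natl mulr2n ltrD.
Qed.

(** The candidates are g_c = c (x_0 + c x_1 + ... + c^n x_n)^d, for c complex.  If
all of them failed, each c would yield a zero of X - g_c R, which is a singular
point of X, together with a grid cell around it in which all singular points
are proportional.  Infinitely many c share the same cell, hence the same
singular line, spanned by x0 say, with X(x0) = mu x0.  But then g_c(x0) = mu for
infinitely many c, and this is a nontrivial polynomial equation in c. *)
Lemma exists_nonvanishing_shift (d : nat) (X : vfield R n) :
  (forall i, hom d.+1 (X i)) -> isolated_singularities X ->
  exists g : S, hom d g /\
    forall x : 'rV[C]_n.+1, x != 0 -> exists i, evalp x (X i - g * mpolyX C (mnm1 i)) != 0.
Proof.
move=> hX isoX.
pose L (c : C) : S := \sum_(i < n.+1) c ^+ i *: mpolyX C (mnm1 i).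
pose g (c : C) : S := c *: L c ^+ d.
have hL c : hom 1%N (L c).
  by apply: rpred_sum => i _; apply: dhomogZ; rewrite dhomogX /= mdeg1.
have hg c : hom d (g c) by apply: dhomogZ; have := dhomogMn d (hL c); rewrite mul1n.
apply: contrapT => /forallNP no.
have /choice[xM hx] : forall c, exists xM : 'rV[C]_n.+1 * nat,
    [/\ xM.1 != 0, forall i, evalp xM.1 (X i) = evalp xM.1 (g c) * xM.1 0 i &
    forall y, grid_code xM.2 xM.1 = grid_code xM.2 y -> vfield_sing X y ->
       exists a : C, y = a *: xM.1].
  move=> c; have /not_andP[//|/existsNP[x /not_implyP[x0 /forallNP hx]]] := no (g c).
  have hX' i : evalp x (X i) = evalp x (g c) * x 0 i.
    have /negP/negPn/eqP := hx i.
    by rewrite /evalp mevalB mevalM mevalXU => /eqP; rewrite subr_eq0 => /eqP.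
  have sx : vfield_sing X x by split=> //; exists (evalp x (g c)).
  have [e e0 he] := near_radius (isoX x sx).
  exists (x, Num.trunc (2 / e)); split=> // y /= /grid_code_close cl; apply: he => i.
  apply: lt_le_trans (cl i) _; rewrite lecR ltW // ltr_pdivrMr ?ltr0n // mulrC.
  by rewrite -ltr_pdivrMr // truncnS_gt.
have [[M cd] inf] := infinite_fiber (fun c => ((xM c).2, grid_code (xM c).2 (xM c).1)).
have [c0 c0in] : exists c0, ((xM c0).2, grid_code (xM c0).2 (xM c0).1) = (M, cd).
  apply: contrapT => /forallNP no0; apply: inf; rewrite (_ : [set _ | _] = set0) //.
  by apply/seteqP; split=> // c /no0.
set x0 := (xM c0).1; have [x0n0 Xx0 isox0] := hx c0; rewrite -/x0 in x0n0 Xx0 isox0.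
have [mu Xmu] : exists mu, forall i, evalp x0 (X i) = mu * x0 0 i.
  by exists (evalp x0 (g c0)).
pose Q : {poly C} := \poly_(i < n.+1) x0 0 (inord i).
pose P : {poly C} := 'X * Q ^+ d - mu%:P.
have Lev c : evalp x0 (L c) = Q.[c].
  rewrite /evalp /L raddf_sum horner_poly /=; apply: eq_bigr => i _.
  by rewrite mevalZ mevalXU inord_val mulrC.
have gev c : P.[c] = evalp x0 (g c) - mu.
  by rewrite /P hornerD hornerN hornerC hornerM hornerX horner_exp -Lev /g /evalp mevalZ rmorphXn.
have Q0 : Q != 0.
  have /rV0Pn[i xi] := x0n0; apply: contraNneq xi => /(congr1 (fun p : {poly C} => p`_i)).
  by rewrite coef0 coef_poly ltn_ord inord_val => ->.
have P0 : P != 0.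
  apply/eqP => e; have mu0 : mu = 0.
    have := congr1 (fun p => p.[0]) e.
    rewrite /P hornerD hornerN hornerC hornerM hornerX horner0 mul0r add0r.
    by move/eqP; rewrite oppr_eq0 => /eqP.
  move/eqP: e; rewrite /P mu0 subr0 mulf_eq0 polyX_eq0 expf_eq0 (negbTE Q0) andbF.
  by [].
have rootE c : ((xM c).2, grid_code (xM c).2 (xM c).1) = (M, cd) -> P.[c] = 0.
  move=> hc; have [xcn0 Xxc _] := hx c.
  have [a xca] : exists a : C, (xM c).1 = a *: x0.
    apply: isox0; last by split=> //; exists (evalp (xM c).1 (g c)).
    by case: c0in hc => <- <- [<-].
  have a0 : a != 0 by apply: contraNneq xcn0 => a0; rewrite xca a0 scale0r.
  have /rV0Pn[i xi] := x0n0.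
  have E : a ^+ d.+1 * (mu * x0 0 i) = a ^+ d * evalp x0 (g c) * (a * x0 0 i).
    have := Xxc i; rewrite xca (evalpZ _ _ (hX i)) (Xmu i) => ->.
    by rewrite (evalpZ _ _ (hg c)) mxE.
  have ad0 : a ^+ d.+1 * x0 0 i != 0 by rewrite mulf_neq0 // expf_neq0.
  rewrite gev; apply: (mulfI ad0); rewrite mulr0 mulrBr; apply/eqP; rewrite subr_eq0; apply/eqP.
  move: E; move: (evalp x0 (g c)) (x0 0 i) (mu) => b y m E.
  by transitivity (a ^+ d.+1 * (m * y)); [rewrite E exprS|]; ring.
have [B BA sB] := infinite_set_fset (size P) inf.
have := max_poly_roots P0 (rs := finmap.enum_fset B) _ (finmap.fset_uniq _).
rewrite ltnNge sB => /(_ _)/negP; apply=> //.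
by apply/allP => c cB; apply/rootP; apply: rootE; apply: (BA c).
Qed.

End Isolated.

(** * The degree of a foliation annihilating a form *)

Section DegreeBound.
Variables (R : realType) (n : nat).
Local Notation C := (CC R).
Local Notation S := (mpoly n.+1 C).
Local Notation I := 'I_n.+1.
Local Notation hom d p := (p \is ishomog1 d mdeg).
Local Notation pih := (@pihomog n.+1 C mdeg).
Implicit Types (w : diff_form n S).

(** The coordinates x_i are linearly independent over the constants. *)
Lemma const_kform_radial p w : is_kform p.+1 w -> (forall s, hom 0%N (w s)) ->
  contract (@radial R n) w = (fun=> 0) -> w = fun=> 0.
Proof.
move=> [w0 _] hw Rw; apply/funext => -[|i s]; first exact: w0.
have := congr1 (fun f => mcoeff (mnm1 i) (f s)) Rw.
rewrite /contract raddf_sum mcoeff0 (bigD1 i) //= big1 => [|j ji].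
  by rewrite (hom0P (hw _)) mulrC mul_mpolyC mcoeffZ mcoeffXU eqxx mulr1 addr0 => ->;
    rewrite mpolyC0.
by rewrite (hom0P (hw _)) mulrC mul_mpolyC mcoeffZ mcoeffXU (negbTE ji) mulr0.
Qed.

Lemma power_in_ideal (f : I -> S) :
  (forall x : 'rV[C]_n.+1, x != 0 -> exists i, evalp x (f i) != 0) ->
  exists (N : nat) (h : I -> I -> S),
    forall j, mpolyX C (mnm_muln (mnm1 j) N) = \sum_i f i * h j i.
Proof.
move=> hf; pose J (p : S) := exists h : I -> S, p = \sum_i f i * h i.
have iJ : is_ideal J.
  split=> [|a b [h ->] [h' ->]|a b [h ->]].
  - by exists (fun=> 0); rewrite big1 // => i _; rewrite mulr0.
  - by exists (fun i => h i + h' i); rewrite -big_split; apply: eq_bigr => i _; rewrite mulrDr.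
  - by exists (fun i => a * h i); rewrite mulr_sumr; apply: eq_bigr => i _; rewrite mulrCA.
have /choice[N hN] : forall j : I, exists N, J (mpolyX C (mnm1 j) ^+ N).
  move=> j; apply: contrapT => /forallNP aJ.
  have [c [Jc cj]] := nullstellensatz iJ aJ.
  have c0 : c != 0.
    by apply: contraNneq cj => ->; rewrite /evalp mevalXU mxE.
  have [i /negP] := hf c c0; apply; apply/eqP/Jc.
  exists (fun k => (k == i)%:R); rewrite (bigD1 i) //= eqxx mulr1 big1 ?addr0 // => k /negbTE ->.
  by rewrite mulr0.
exists (\max_j N j)%N.
suff /choice[h hh] : forall j, J (mpolyX C (mnm_muln (mnm1 j) (\max_j N j)%N)) by exists h.
move=> j; rewrite -mpolyXn -(subnK (leq_bigmax j)) exprD; exact: idealM.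
Qed.

(** The graded form of Koszul exactness: the primitive can be taken homogeneous,
and there is none, so that w = 0, when its degree would be negative. *)
Lemma koszul_nonvanishing (f : I -> S) D p e w :
  (forall x : 'rV[C]_n.+1, x != 0 -> exists i, evalp x (f i) != 0) ->
  (forall i, hom D (f i)) -> is_kform p.+1 w -> (forall s, hom e (w s)) ->
  contract f w = (fun=> 0) ->
  if (D <= e)%N then exists eta : diff_form n S,
      [/\ is_kform p.+2 eta, forall s, hom (e - D)%N (eta s) & w = contract f eta]
  else w = fun=> 0.
Proof.
move=> hf hD kw hw fw; have [N [h hh]] := power_in_ideal hf.
have [eta [[e0 eA] we]] := koszul_exact hh kw fw.
have weE s : w s = \sum_i pih e (f i * eta (i :: s)).
  by rewrite -raddf_sum -[LHS](pihomog_dE (hw s)) we.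
case: leqP => De.
  exists (fun s => pih (e - D)%N (eta s)); split.
  - split=> [s ns|s1 i j s2]; first by rewrite e0 // raddf0.
    by rewrite eA raddfN.
  - by move=> s; apply: pihomogP.
  - apply/funext => s; rewrite weE; apply: eq_bigr => i _.
    by rewrite (pihomogM_hom _ _ (hD i)) De.
apply/funext => s; rewrite weE big1 // => i _.
by rewrite (pihomogM_hom _ _ (hD i)) leqNgt De.
Qed.

Lemma hom_radial i : hom 1%N (@radial R n i).
Proof. by rewrite dhomogX /= mdeg1. Qed.

(** With all arguments but two fixed, w is a constant skew matrix M, and the
hypothesis says that the quadratic form x A M x^T vanishes, where A is the
matrix of X: so A is self-adjoint for M. *)
Lemma linear_field_const_form (X : vfield R n) p w :
  (forall i, hom 1%N (X i)) -> isolated_singularities X ->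
  is_kform p.+2 w -> (forall s, hom 0%N (w s)) ->
  contract X (contract (@radial R n) w) = (fun=> 0) -> w = fun=> 0.
Proof.
move=> hX isoX [w0 wA] hw XRw.
apply/funext => -[|j [|i s]]; [exact: w0|exact: w0|].
pose A : 'M[C]_n.+1 := \matrix_(l, a) mcoeff (mnm1 l) (X a).
pose M : 'M[C]_n.+1 := \matrix_(a, b) mcoeff (@mnm0 n.+1) (w [:: b, a & s]).
have XA (x : 'rV[C]_n.+1) a : evalp x (X a) = (x *m A) 0 a.
  rewrite (hom1P (hX a)) /evalp raddf_sum mxE; apply: eq_bigr => l _ /=.
  by rewrite mevalZ mevalXU mxE mulrC.
have wM a b (x : 'rV[C]_n.+1) : evalp x (w [:: b, a & s]) = M a b.
  by rewrite (hom0P (hw _)) /evalp mevalC mxE.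
have skM : M^T = - M.
  apply/matrixP => a b; rewrite !mxE -mcoeffN; congr mcoeff; exact: (wA [::]).
have quad (x : 'rV[C]_n.+1) : x *m (A *m M) *m x^T = 0.
  apply/matrixP => a b; rewrite !ord1 mxE [RHS]mxE.
  have := congr1 (fun f => evalp x (f s)) XRw.
  rewrite /evalp meval0 raddf_sum /= => H; rewrite -[RHS]H mulmxA.
  under eq_bigr do rewrite mxE mulr_suml.
  rewrite exchange_big; apply: eq_bigr => c _ /=.
  rewrite mevalM -/(evalp x _) XA raddf_sum mulr_sumr; apply: eq_bigr => l _ /=.
  by rewrite mevalM mevalXU -/(evalp x _) wM [x^T _ _]mxE mulrAC mulrA.
have F2 (a : C) : a = - a -> a = 0.
  by move/eqP; rewrite -subr_eq0 opprK -mulr2n mulrn_eq0 => /eqP.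
have bil (x y : 'rV[C]_n.+1) : x *m (A *m M) *m y^T + y *m (A *m M) *m x^T = 0.
  have := quad (x + y); rewrite linearD /= !mulmxDl !mulmxDr !quad.
  by rewrite addr0 add0r.
have skAM : (A *m M)^T = - (A *m M).
  apply/matrixP => a b.
  have := congr1 (fun Z : 'M[C]_1 => Z 0 0) (bil (delta_mx 0 a) (delta_mx 0 b)).
  rewrite -!rowE !trmx_delta -!colE !mxE => /eqP.
  by rewrite addr_eq0 => /eqP e; rewrite e opprK.
have AM : A *m M = M *m A^T.
  by apply: oppr_inj; rewrite -skAM trmx_mul skM mulNmx.
have M0 : M = 0.
  apply: (skew_selfadjoint_eq0 F2 _ skM AM) => lam.
  have [->|] := eqVneq (kermx (A - lam%:M)) 0; first by rewrite mxrank0.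
  case/rowV0Pn => x xk x0.
  have eig (y : 'rV[C]_n.+1) : (y <= kermx (A - lam%:M))%MS -> y *m A = lam *: y.
    by move/sub_kermxP/eqP; rewrite mulmxBr mul_mx_scalar subr_eq0 => /eqP.
  apply: leq_trans (rank_leq_row x); apply: mxrankS; apply/row_subP => k.
  have [c ->] := isolated_eigen isoX XA x0 (eig _ xk) (eig _ (row_sub k _)).
  exact: scalemx_sub.
rewrite (hom0P (hw _)); have := congr1 (fun Z : 'M[C]_n.+1 => Z i j) M0.
by rewrite !mxE => ->; rewrite mpolyC0.
Qed.

(** The field X' = X - g R annihilates w because both X and R do.  Koszul exactness
applies to X' and leaves only the case e = D, in which the primitive eta of w is
constant. *)
Theorem foliation_degree_lt (X : vfield R n) D p e w :
  (forall i, hom D (X i)) -> isolated_singularities X ->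
  is_kform p.+1 w -> (forall s, hom e (w s)) ->
  contract (@radial R n) w = (fun=> 0) -> contract X w = (fun=> 0) ->
  w <> (fun=> 0) -> (D < e)%N.
Proof.
move=> hX isoX kw hw Rw Xw w0; rewrite ltnNge; apply/negP => eD; apply: w0.
have [e0|ne0] := eqVneq e 0%N.
  by apply: const_kform_radial kw _ Rw => s; have := hw s; rewrite e0.
case: D hX eD => [|d] hX eD; first by rewrite leqn0 (negbTE ne0) in eD.
have [g [hg nv]] := exists_nonvanishing_shift hX isoX.
pose X' i := X i - g * mpolyX C (mnm1 i).
have hX' i : hom d.+1 (X' i).
  by rewrite /X' rpredB //; have := dhomogM hg (hom_radial i); rewrite addn1.
have X'E (v : diff_form n S) :
    contract X' v = fun s => contract X v s - g * contract (@radial R n) v s.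
  apply/funext => s; rewrite /contract mulr_sumr -sumrB; apply: eq_bigr => i _.
  by rewrite /X' /radial; ring.
have X'w : contract X' w = fun=> 0.
  by rewrite X'E Rw Xw; apply/funext => s; rewrite mulr0 subr0.
have := koszul_nonvanishing nv hX' kw hw X'w.
case: ifP => [De|//]; have eE : e = d.+1 by apply/eqP; rewrite eqn_leq eD De.
rewrite eE subnn => -[eta [ke he we]].
have RX'eta : contract X' (contract (@radial R n) eta) = fun=> 0.
  rewrite (contract_anticomm _ _ ke.2) -we Rw; apply/funext => s; exact: oppr0.
suff e0 : eta = fun=> 0 by rewrite we e0 contract0.
have [d0|d0] := posnP d.
  rewrite d0 in hX; apply: (linear_field_const_form hX isoX ke he); apply/funext => s.
  have := congr1 (fun f => f s) RX'eta; rewrite X'E contractK ?mulr0 ?subr0 //.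
    exact: mpoly_double_eq0.
  exact: ke.2.
have kR := contract_kform (@radial R n) ke.
have hR s : hom 1%N (contract (@radial R n) eta s).
  by apply: rpred_sum => i _; rewrite -[1%N]addn0; apply: dhomogM => //; exact: hom_radial.
have := koszul_nonvanishing nv hX' kR hR RX'eta.
rewrite ltnS leqn0 (gtn_eqF d0) => Reta; exact: const_kform_radial ke he Reta.
Qed.

End DegreeBound.

(** * Fractions, dual frames and the volume form *)

Section Fractions.
Variable A : idomainType.
Local Notation K := {fraction A}.

Lemma frac_num_den (k : K) : exists a b : A, b != 0 /\ tofrac b * k = tofrac a.
Proof.
elim/quotW: k => -[[a b] /= b0]; exists a, b; split=> //.
rewrite -[LHS]/(FracField.mul (FracField.tofrac b) (\pi_(FracField.type A) _)%qT) !piE.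
apply/eqmodP; rewrite /= FracField.equivfE /FracField.mulf /=.
rewrite !numden_Ratio ?oner_neq0 ?mul1r ?mulr1 //=.
Qed.

Lemma common_denominator (T : finType) (c : T -> K) :
  exists (D : A) (c' : T -> A), D != 0 /\ forall a, tofrac D * c a = tofrac (c' a).
Proof.
have /choice[num hnum] : forall t, exists ab : A * A, ab.2 != 0 /\ tofrac ab.2 * c t = tofrac ab.1.
  by move=> t; have [a [b h]] := frac_num_den (c t); exists (a, b).
exists (\prod_t (num t).2), (fun t => (num t).1 * \prod_(t' | t' != t) (num t').2).
split; first by apply/prodf_neq0 => t _; case: (hnum t).
move=> t; have [_ e] := hnum t; rewrite (bigD1 t) //= !rmorphM /= -e; ring.
Qed.

Lemma poly_common_denominator (p : {poly K}) :
  exists (D : A) (p' : {poly A}), D != 0 /\ (tofrac D) *: p = map_poly (@tofrac A) p'.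
Proof.
have [D [c [D0 hc]]] := common_denominator (fun i : 'I_(size p) => p`_i).
exists D, (\poly_(i < size p) (if insub i is Some j then c j else 0)); split=> //.
apply/polyP => i; rewrite coefZ coef_map coef_poly /=.
case: ltnP => [lt|le]; last by rewrite nth_default // mulr0 rmorph0.
by rewrite insubT; exact: (hc (Sub i lt)).
Qed.

End Fractions.

Section DualChains.
Variables (n : nat) (A : comNzRingType) (T : eqType).
Local Notation I := 'I_n.+1.
Implicit Types (w : diff_form n A) (V h : T -> I -> A) (l : seq T).

(** The chains below are inverse to each other on forms annihilated by the V a,
when V and h are dual; the list l fixes the order of the factors. *)
Definition wedge_chain h l w : diff_form n A := foldr (fun a => wedge (h a)) w l.
Definition contract_chain V l w : diff_form n A := foldl (fun w a => contract (V a) w) w l.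

Lemma wedge_chain_kform k h l w : is_kform k w -> is_kform (size l + k) (wedge_chain h l w).
Proof. by move=> kw; elim: l => //= a l IH; apply: wedge_kform. Qed.

Lemma contract_chainK V h l w : (forall a b, \sum_i V a i * h b i = (a == b)%:R) ->
  (forall a, contract (V a) w = fun=> 0) -> uniq l ->
  contract_chain V l (wedge_chain h l w) = w.
Proof.
move=> dual Vw.
have out a l' : a \notin l' -> contract (V a) (wedge_chain h l' w) = fun=> 0.
  elim: l' => [|b l' IH] //=; rewrite inE negb_or => /andP[ab al].
  apply/funext => s; rewrite contract_wedge dual (negbTE ab) mul0r sub0r.
  by rewrite IH // wedge0 oppr0.
elim: l => //= a l IH /andP[al ul]; rewrite -[RHS]IH //; congr contract_chain.
apply/funext => s; rewrite contract_wedge dual eqxx mul1r out //.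
by rewrite wedge0 subr0.
Qed.

Lemma contract_chainZ V l c w :
  contract_chain V l (fun s => c * w s) = fun s => c * contract_chain V l w s.
Proof. by elim: l w => //= a l IH w; rewrite contractZ IH. Qed.

Lemma contract_chain0 V l : contract_chain V l (fun=> 0) = fun=> 0.
Proof. by elim: l => //= a l IH; rewrite contract0. Qed.

End DualChains.

Section Volume.
Variables (n : nat) (A : comNzRingType).
Local Notation I := 'I_n.+1.

Definition unit_form : diff_form n A := fun s => (s == [::])%:R.

Definition volume : diff_form n A :=
  wedge_chain (fun a i : I => (a == i)%:R) (enum I) unit_form.

Lemma unit_kform : is_kform 0 unit_form.
Proof.
split=> [[]//|s1 i j s2]; rewrite /unit_form.
by case: s1 => [|? ?] /=; rewrite oppr0.
Qed.

Lemma volume_kform : is_kform n.+1 volume.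
Proof.
have := wedge_chain_kform (fun a i : I => (a == i)%:R) (enum I) unit_kform.
by rewrite size_enum_ord addn0.
Qed.

Lemma volume_neq0 : (forall a : A, a + a = 0 -> a = 0) -> volume (enum I) != 0.
Proof.
move=> A2; apply/eqP => v0; have vz : volume = fun=> 0.
  by apply/funext => s; apply: kform_top v0 => //; apply: volume_kform.
have := @contract_chainK n A I (fun a i => (a == i)%:R) (fun a i => (a == i)%:R) (enum I) unit_form.
rewrite -/volume vz contract_chain0 => E.
have : (fun=> 0) = unit_form :> (seq I -> A).
  apply: E; last exact: enum_uniq.
    move=> a b; rewrite (bigD1 a) //= eqxx mul1r big1 ?addr0 1?eq_sym // => i ia.
    by rewrite eq_sym (negbTE ia) mul0r.
  by move=> a; apply/funext => s; rewrite /contract big1 // => i _; rewrite mulr0.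
by move=> /(congr1 (fun f => f [::])) /eqP; rewrite /unit_form eqxx eq_sym oner_eq0.
Qed.

End Volume.

(** * Vector fields tangent to a decomposable form *)

Section Cramer.
Variables (R : realType) (n : nat).
Local Notation C := (CC R).
Local Notation S := (mpoly n.+1 C).
Local Notation I := 'I_n.+1.

(** The origin is excluded because forms on projective space are only compared
at nonzero vectors. *)
Lemma mpoly_eq0_punctured (p : S) :
  (forall x : 'rV[C]_n.+1, x != 0 -> evalp x p = 0) -> p = 0.
Proof.
move=> h; apply/eqP/negPn/negP => p0.
have X0 : mpolyX C (mnm1 (ord0 : I)) != 0 by rewrite -msize_poly_eq0 msizeX.
have [c] := mpoly_nonzero_point (mulf_neq0 p0 X0).
rewrite /evalp mevalM mevalXU mulf_eq0 negb_or => /andP[pc c0].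
by case/negP: pc; apply/eqP; apply: h; apply: contraNneq c0 => ->; rewrite mxE.
Qed.

(** Cramer's rule for the columns of h indexed by t, with right-hand side the
column i; replacing an entry of t by i replaces a column of the matrix. *)
Lemma cramer_set_nth m (h : 'I_m -> I -> C) (t : seq I) i a : size t = m ->
  \det (\matrix_(c, b) h c (nth ord0 t b)) * h a i =
  \sum_(b < m) h a (nth ord0 t b) * \det (\matrix_(c, b') h c (nth ord0 (set_nth ord0 t b i) b')).
Proof.
move=> st; set T := \matrix_(_, _) h _ _.
have cof (b : 'I_m) : \det (\matrix_(c, b') h c (nth ord0 (set_nth ord0 t b i) b')) =
    \sum_c \adj T b c * h c i.
  rewrite (expand_det_col _ b); apply: eq_bigr => c _.
  rewrite mxE nth_set_nth /= eqxx mulrC [in RHS]mxE /cofactor; congr (_ * \det _ * _).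
  apply/matrixP => c' b'; rewrite !mxE nth_set_nth /=.
  by rewrite eq_sym (negbTE (neq_bump b b')).
have E : \det T *: (\col_c h c i) = T *m (\adj T *m \col_c h c i).
  by rewrite mulmxA mul_mx_adj mul_scalar_mx.
have := congr1 (fun M : 'cV[C]_m => M a 0) E; rewrite mxE [X in _ * X]mxE => ->.
rewrite mxE; apply: eq_bigr => b _; rewrite cof !mxE; congr (_ * _).
by apply: eq_bigr => c _; rewrite [X in _ * X]mxE.
Qed.

(** At a point where w is the exterior product of the linear forms h_a, this
field is annihilated by every h_a, by Cramer's rule.  Its coefficients are those
of w, so it is polynomial and homogeneous; these fields span the kernel of w
generically. *)
Lemma contract_cramer k (w : diff_form n S) (t : seq I) i :
  locally_decomposable k.+1 w -> is_kform k.+1 w -> size t = k.+1 ->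
  contract (fun j => (j == i)%:R * w t
     - \sum_(b < k.+1) (j == nth ord0 t b)%:R * w (set_nth ord0 t b i)) w = fun=> 0.
Proof.
move=> dec kw st; set u := fun j : I => _.
apply/funext => s; apply: mpoly_eq0_punctured => x x0.
have [/eqP ss|/eqP ns] := boolP (size s == k); last first.
  rewrite /contract big1 ?/evalp ?meval0 // => j _.
  by rewrite kw.1 ?mulr0 //= => -[].
have [sx|nsx] := pselect (pfaff_sing w x).
  by rewrite /evalp raddf_sum big1 // => j _ /=; rewrite mevalM -!/(evalp x _) sx.2 mulr0.
have [eta /nbhs_singleton [_ hx]] := dec x x0 nsx.
pose h a j : C := eta a j x.
have key a : \sum_j evalp x (u j) * h a j = 0.
  have uE j : evalp x (u j) = (j == i)%:R * evalp x (w t)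
     - \sum_(b < k.+1) (j == nth ord0 t b)%:R * evalp x (w (set_nth ord0 t b i)).
    rewrite /evalp /u mevalB mevalM rmorph_nat [X in _ - X](raddf_sum (meval _)) /=; congr (_ - _).
    by apply: eq_bigr => b _; rewrite mevalM rmorph_nat.
  under eq_bigr do rewrite uE mulrBl mulr_suml.
  rewrite sumrB (bigD1 i) //= eqxx mul1r big1 ?addr0 => [|j /negbTE ->];
    last by rewrite !mul0r.
  apply/eqP; rewrite subr_eq0 hx // (cramer_set_nth h i a st); apply/eqP.
  rewrite exchange_big; apply: eq_bigr => b _.
  rewrite (bigD1 (nth ord0 t b)) //= eqxx mul1r big1 ?addr0 => [|j /negbTE ->];
    last by rewrite !mul0r.
  by rewrite mulrC hx // size_set_nth st; apply/maxn_idPr.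
rewrite /evalp /contract raddf_sum /=.
pose cof a : C := cofactor (\matrix_(a, b < k.+1) h a (nth ord0 (ord0 :: s) b)) a ord0.
have wE j : meval [eta x 0] (u j * w (j :: s)) = \sum_a cof a * (evalp x (u j) * h a j).
  rewrite mevalM -!/(evalp x _) hx /= ?ss // (expand_det_col _ ord0) mulr_sumr.
  apply: eq_bigr => a _; rewrite mxE /=.
  have -> : cofactor (\matrix_(a, b < k.+1) eta a (nth ord0 (j :: s) b) x) a ord0 = cof a.
    by congr (_ * \det _); apply/matrixP => c b; rewrite !mxE.
  by rewrite [RHS]mulrCA [X in _ = _ * X]mulrC.
under eq_bigr do rewrite wE.
by rewrite exchange_big big1 // => a _; rewrite -mulr_sumr key mulr0.
Qed.

End Cramer.

(** * The frame of a split tangent sheaf *)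

Section Split.
Variables (R : realType) (n : nat).
Local Notation C := (CC R).
Local Notation S := (mpoly n.+1 C).
Local Notation K := {fraction S}.
Local Notation I := 'I_n.+1.
Local Notation hom d p := (p \is ishomog1 d mdeg).
Local Notation pih := (@pihomog n.+1 C mdeg).
Local Notation x0 := (mpolyX C (mnm1 (ord0 : I)) : S).

Lemma O_section0 m : O_section m (0 : S).
Proof. by case: m => // d; apply: dhomog0. Qed.

Lemma O_section_hom m k (p : S) : m = Posz k -> hom k p -> O_section m p.
Proof. by move=> ->. Qed.

Lemma x0_neq0 : x0 != 0.
Proof. by rewrite -msize_poly_eq0 msizeX. Qed.

Lemma hom_x0 : hom 1%N x0.
Proof. by rewrite dhomogX /= mdeg1. Qed.

Variables (r : nat) (dn : 'I_r -> nat) (Y : 'I_r -> vfield R n).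
Hypothesis hY : forall i j, hom (dn i) (Y i j).

(** The radial field in position 0, then the Y_i: a basis, over the rational
functions, of the kernel of the form on the cone. *)
Definition frame (a : 'I_r.+1) : vfield R n :=
  if unlift ord0 a is Some i then Y i else @radial R n.
Definition frame_deg (a : 'I_r.+1) : nat :=
  if unlift ord0 a is Some i then dn i else 1%N.

Lemma hom_frame a j : hom (frame_deg a) (frame a j).
Proof. by rewrite /frame /frame_deg; case: unliftP => [i _|_] //; apply: hom_radial. Qed.

Definition frame_mx : 'M[K]_(r.+1, n.+1) := \matrix_(a, j) tofrac (frame a j).

Lemma frame0 j : frame ord0 j = radial R j.
Proof. by rewrite /frame unlift_none. Qed.

Lemma frameS i j : frame (lift ord0 i) j = Y i j.
Proof. by rewrite /frame liftK. Qed.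

(* injectivity of the splitting over the open set x_0 <> 0 *)
Hypothesis inj : forall (a : 'I_r -> K) (b : K),
  (forall i, O_section_on x0 1 (1 - Posz (dn i)) (a i)) ->
  O_section_on x0 1 0 b ->
  (forall j, \sum_(i < r) a i * tofrac (Y i j) = b * tofrac (radial R j)) ->
  forall i, a i = 0.

(** A relation with rational coefficients can be cleared of denominators and cut
into its homogeneous parts; divided by a power of x_0, the part of degree N is a
relation between sections over x_0 <> 0. *)
Lemma frame_row_free : row_free frame_mx.
Proof.
have tx0 : tofrac x0 != 0 by rewrite tofrac_eq0 x0_neq0.
apply: inj_row_free => v vV.
have [D [c [D0 hc]]] := common_denominator (fun a => v 0 a).
have cV j : \sum_a c a * frame a j = 0.
  apply/eqP; rewrite -tofrac_eq0 rmorph_sum; apply/eqP.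
  have := congr1 (fun M : 'rV[K]_n.+1 => M 0 j) vV; rewrite !mxE => e.
  transitivity (tofrac D * 0 : K); last by rewrite mulr0.
  rewrite -[X in tofrac D * X]e mulr_sumr; apply: eq_bigr => a _.
  by rewrite rmorphM /= -hc mxE mulrA.
suff c0 a : c a = 0.
  apply/rowP => a; rewrite mxE; apply: (mulfI (_ : tofrac D != 0)).
    by rewrite tofrac_eq0.
  by rewrite hc c0 mulr0 rmorph0.
have cY i : c (lift ord0 i) = 0.
  (* the part of degree N of the relation; parts of negative degree are zero *)
  pose comp N (a' : 'I_r.+1) : S :=
    if (frame_deg a' <= N)%N then pih (N - frame_deg a') (c a') else 0.
  have rel N j : \sum_a' comp N a' * frame a' j = 0.
    have := congr1 (pih N) (cV j); rewrite raddf0 raddf_sum => H; rewrite -[RHS]H.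
    apply: eq_bigr => a' _; rewrite mulrC [in RHS]mulrC /=.
    rewrite (pihomogM_hom _ _ (hom_frame a' j)) /comp.
    by case: ifP => _; rewrite ?mulr0.
  have hcomp N a' : O_section ((N * 1)%N%:Z + (1 - (frame_deg a')%:Z)) (comp N a' * x0).
    rewrite /comp; case: leqP => [le|_]; last by rewrite mul0r; apply: O_section0.
    apply: (@O_section_hom _ (N - frame_deg a' + 1)%N); first lia.
    by apply: dhomogM; [apply: pihomogP | apply: hom_x0].
  have z N : comp N (lift ord0 i) = 0.
    pose al a' : K := tofrac (comp N a' * x0) / tofrac x0 ^+ N.
    have /eqP : al (lift ord0 i) = 0.
      apply: (inj (a := fun i => al (lift ord0 i)) (b := - al ord0)).
      - move=> i'; exists N, (comp N (lift ord0 i') * x0); split=> //.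
        by have := hcomp N (lift ord0 i'); rewrite /frame_deg liftK.
      - exists N, (- comp N ord0 * x0); split; last by rewrite mulNr rmorphN mulNr.
        have := hcomp N ord0; rewrite {1}/frame_deg unlift_none subrr.
        by case: (_ + _) => d /=; rewrite mulNr ?rpredN // => ->; rewrite oppr0.
      - move=> j; have := congr1 (fun p => tofrac (p * x0) / tofrac x0 ^+ N) (rel N j).
        rewrite big_ord_recl mul0r rmorph0 mul0r mulrDl rmorphD mulrDl /= frame0 => /eqP.
        rewrite addrC addr_eq0 => /eqP e; rewrite mulNr.
        transitivity (- (tofrac (comp N ord0 * radial R j * x0) / tofrac x0 ^+ N)); last first.
          by congr (- _); rewrite /al !rmorphM /=; ring.
        rewrite -e mulr_suml rmorph_sum mulr_suml; apply: eq_bigr => i' _.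
        by rewrite /al frameS !rmorphM /=; ring.
    rewrite mulf_eq0 invr_eq0 expf_eq0 (negbTE tx0) andbF orbF tofrac_eq0 mulf_eq0.
    rewrite (negbTE x0_neq0) orbF; by move/eqP.
  rewrite [LHS](@pihomog_partitionE _ _ mdeg (msize (c (lift ord0 i)))) // big1 // => m _.
  by have := z (m + frame_deg (lift ord0 i))%N; rewrite /comp leq_addl addnK.
have [i ->|->] := unliftP ord0 a; first exact: cY.
have := cV ord0; rewrite big_ord_recl big1 => [|i _]; last by rewrite cY mul0r.
rewrite addr0 frame0 => /eqP; rewrite mulf_eq0 (negbTE x0_neq0) orbF; by move/eqP.
Qed.

Variables (k e : nat) (w : diff_form n S).
Hypothesis (kw : is_kform k.+1 w) (hw : forall s, hom e (w s)).
Hypothesis Rw : contract (@radial R n) w = fun=> 0.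
Hypothesis Yw : forall i, contract (Y i) w = fun=> 0.
Hypothesis dec : locally_decomposable k.+1 w.
(* surjectivity of the splitting over the same open set *)
Hypothesis surj : forall v, tangent_section_on w x0 1 v ->
  exists (a : 'I_r -> K) (b : K),
    [/\ forall i, O_section_on x0 1 (1 - Posz (dn i)) (a i), O_section_on x0 1 0 b
      & forall j, v j = \sum_(i < r) a i * tofrac (Y i j) + b * tofrac (radial R j)].

Let wK : diff_form n K := fun s => tofrac (w s).

Lemma contract_tofrac (v : I -> S) (u : diff_form n S) :
  contract (fun j => tofrac (v j)) (fun s => tofrac (u s)) = fun s => tofrac (contract v u s).
Proof.
apply/funext => s; rewrite /contract rmorph_sum; apply: eq_bigr => j _.
by rewrite rmorphM.
Qed.

Lemma tangent_sub_frame (u : vfield R n) m : (forall j, hom m (u j)) ->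
  contract u w = (fun=> 0) -> ((\row_j tofrac (u j) : 'rV[K]_n.+1) <= frame_mx)%MS.
Proof.
move=> hu uw; have tx0 : tofrac x0 != 0 by rewrite tofrac_eq0 x0_neq0.
pose g : K := tofrac x0 / tofrac x0 ^+ m.
have g0 : g != 0.
  by rewrite /g mulf_eq0 invr_eq0 expf_eq0 (negbTE tx0) andbF.
have [|a [b [_ _ E]]] := surj (v := fun j => tofrac (u j * x0) / tofrac x0 ^+ m).
  split=> [j|s].
    exists m, (u j * x0); split=> //; apply: (@O_section_hom _ (m + 1)%N); first lia.
    by apply: dhomogM => //; apply: hom_x0.
  transitivity (g * contract (fun j => tofrac (u j)) wK s).
    rewrite /contract mulr_sumr; apply: eq_bigr => j _.
    by rewrite /g rmorphM /=; ring.
  by rewrite contract_tofrac uw rmorph0 mulr0.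
pose c : 'rV[K]_r.+1 := \row_a' (if unlift ord0 a' is Some i then a i else b).
apply/submxP; exists (g^-1 *: c); apply/rowP => j.
rewrite -scalemxAl !mxE big_ord_recl !mxE unlift_none frame0.
apply: (mulfI g0); rewrite mulrA mulfV // mul1r.
have := E j; rewrite rmorphM /= => E'.
transitivity (tofrac (u j) * tofrac x0 / tofrac x0 ^+ m); first by rewrite /g; ring.
rewrite E' addrC; congr (_ + _); apply: eq_bigr => i _.
by rewrite !mxE liftK frameS.
Qed.

(** The fields of [contract_cramer], for the n + 1 - (k + 1) indices i outside t,
are independent, because their components with index outside t form w_t times
the identity matrix. *)
Lemma frame_large t : w t != 0 -> (n.+1 <= r.+1 + k.+1)%N.
Proof.
move=> wt0; have st : size t = k.+1 by apply: contrapT => /kw.1 z; rewrite z eqxx in wt0.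
have ut : uniq t.
  by apply: contraNT wt0 => /(alternating_nuniq (@mpoly_double_eq0 _ _) kw.2) ->.
pose u i := fun j : I => (j == i)%:R * w t
     - \sum_(b < k.+1) (j == nth ord0 t b)%:R * w (set_nth ord0 t b i).
have hu i j : hom e (u i j).
  rewrite /u rpredB //; first by rewrite mulr_natl rpredMn.
  by apply: rpred_sum => b _; rewrite mulr_natl rpredMn.
have uw i : contract (u i) w = fun=> 0 by apply: contract_cramer.
pose t' := [seq i <- enum I | i \notin t].
have st' : size t' = (n.+1 - k.+1)%N.
  have := count_predC (fun i => i \in t) (enum {: I}); rewrite -size_filter.
  rewrite -[X in (_ + X)%N]size_filter size_enum_ord -/t'.
  suff -> : size [seq i <- enum I | i \in t] = k.+1 by lia.
  transitivity (size t) => //; apply: perm_size; apply: uniq_perm => //.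
    by rewrite filter_uniq // enum_uniq.
  by move=> i; rewrite mem_filter mem_enum andbT.
pose m := size t'.
pose U : 'M[K]_(m, n.+1) := \matrix_(l, j) tofrac (u (nth ord0 t' l) j).
pose P : 'M[K]_(n.+1, m) := \matrix_(j, l) (j == nth ord0 t' l)%:R.
have UP : U *m P = (tofrac (w t))%:M.
  apply/matrixP => l l'; rewrite !mxE (bigD1 (nth ord0 t' l')) //= big1 ?addr0 => [|j jl].
    rewrite !mxE eqxx mulr1 /u big1 ?subr0 => [|b _]; last first.
      have : nth ord0 t' l' \notin t.
        by have := mem_nth ord0 (ltn_ord l'); rewrite mem_filter => /andP[].
      case: eqP => [->|_ _]; last by rewrite mul0r.
      by rewrite mem_nth // st.
    have ut' : uniq t' by rewrite filter_uniq // enum_uniq.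
    have [->|ll'] := eqVneq l l'; first by rewrite eqxx mul1r.
    rewrite nth_uniq // -[(_ == _)%N]/(l' == l) eq_sym (negbTE ll').
    by rewrite mul0r rmorph0.
  by rewrite !mxE (negbTE jl) mulr0.
have rkU : (m <= \rank U)%N.
  apply: leq_trans (mxrankM_maxl U P); rewrite UP mxrank_unit // unitmxE det_scalar.
  by rewrite unitrX // unitfE tofrac_eq0.
have UV : (U <= frame_mx)%MS.
  apply/row_subP => l.
  have -> : row l U = \row_j tofrac (u (nth ord0 t' l) j) by apply/rowP => j; rewrite !mxE.
  exact: tangent_sub_frame (hu _) (uw _).
have := leq_trans rkU (leq_trans (mxrankS UV) (rank_leq_row _)).
rewrite /m st'; lia.
Qed.

(** Let h be dual to the frame.  The exterior product Om of w with all the h_a has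
degree (r + 1) + (k + 1) and gives back w when contracted with the frame; since w
is not zero, neither is Om, which bounds r from above.  Then Om has top degree,
so it is a multiple c of the volume form, and w is c times the contraction Phi of
the volume form with the frame. *)
Theorem split_tangent_sheaf_form t : w t != 0 ->
  r = (n - k.+1)%N /\ exists Phi : diff_form n S,
    [/\ forall s, hom (1 + \sum_i dn i)%N (Phi s),
        forall s, w t * Phi s = Phi t * w s & Phi t != 0].
Proof.
move=> wt0; have large := frame_large wt0.
have := frame_row_free => /row_freeP[B VB].
pose V (a : 'I_r.+1) (j : I) : K := tofrac (frame a j).
pose h (a : 'I_r.+1) (j : I) : K := B j a.
have dual a b : \sum_j V a j * h b j = (a == b)%:R.
  have := congr1 (fun M : 'M[K]_r.+1 => M a b) VB; rewrite !mxE => H; rewrite -[RHS]H.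
  by apply: eq_bigr => j _; rewrite mxE.
have kwK : is_kform k.+1 wK.
  split=> [s ns|s1 i j s2]; first by rewrite /wK kw.1 ?rmorph0.
  by rewrite /wK kw.2 rmorphN.
have VwK a : contract (V a) wK = fun=> 0.
  rewrite contract_tofrac; apply/funext => s; apply/eqP; rewrite tofrac_eq0; apply/eqP.
  by rewrite /frame; case: unlift => [i|]; rewrite ?Yw ?Rw.
pose Om := wedge_chain h (enum 'I_r.+1) wK.
have kOm : is_kform (r.+1 + k.+1) Om.
  by have := wedge_chain_kform h (enum 'I_r.+1) kwK; rewrite size_enum_ord.
have wE : wK = contract_chain V (enum 'I_r.+1) Om.
  by rewrite contract_chainK // enum_uniq.
have wKt : wK t != 0 by rewrite /wK tofrac_eq0.
have small : (r.+1 + k.+1 <= n.+1)%N.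
  rewrite leqNgt; apply/negP => gt; case/eqP: wKt; rewrite wE.
  rewrite (_ : Om = fun=> 0) ?contract_chain0 //; apply/funext => s.
  exact: (kform_gt (@frac_double_eq0 _ _) s kOm).
have rk : (r.+1 + k.+1 = n.+1)%N by apply/eqP; rewrite eqn_leq small large.
split; first lia.
rewrite rk in kOm.
pose vol : diff_form n S := @volume n S.
have vol0 : vol (enum {: I}) != 0 by apply: volume_neq0; apply: mpoly_double_eq0.
pose volK : diff_form n K := fun s => tofrac (vol s).
pose c : K := Om (enum {: I}) / volK (enum {: I}).
have volK0 : volK (enum {: I}) != 0 by rewrite /volK tofrac_eq0.
have OmE : Om = fun s => c * volK s.
  apply/funext => s; apply/eqP; rewrite -subr_eq0; apply/eqP.
  apply: (kform_top (@frac_double_eq0 _ _) (w := fun s => Om s - c * volK s)).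
    case: (@volume_kform n S) => v0 vA; case: kOm => o0 oA.
    split=> [s' ns|s1 i j s2]; first by rewrite o0 // /volK /vol v0 // rmorph0 mulr0 subr0.
    by rewrite oA /volK /vol vA rmorphN mulrN opprB opprK addrC.
  by rewrite /c divfK // subrr.
pose Phi : diff_form n S := contract_chain (fun a j => frame a j) (enum 'I_r.+1) vol.
have PhiK : contract_chain V (enum 'I_r.+1) volK = fun s => tofrac (Phi s).
  rewrite /Phi /volK; move: (vol) => u; elim: (enum _) u => //= a l IH u.
  by rewrite contract_tofrac IH.
have wPhi s : wK s = c * tofrac (Phi s).
  by rewrite wE OmE contract_chainZ PhiK.
exists Phi; split.
- have hdeg l e0 (u : diff_form n S) : (forall s, hom e0 (u s)) ->
      forall s, hom (\sum_(a <- l) frame_deg a + e0)%N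
                    (contract_chain (fun a j => frame a j) l u s).
    elim: l e0 u => [|a l IH] e0 u hu s; first by rewrite big_nil.
    rewrite big_cons -addnA addnCA; apply: IH => s'.
    by apply: rpred_sum => j _; apply: dhomogM => //; apply: hom_frame.
  have hvol s : hom 0%N (vol s).
    rewrite /vol /volume; elim: (enum {: I}) s => [|a l IH] s /=.
      by rewrite /unit_form; case: (_ == _); rewrite ?dhomog0 ?dhomog1.
    move: (wedge_chain _ l _) IH => u; elim: s u => [|i s IHs] u hu /=; first exact: dhomog0.
    by apply: rpredB; [rewrite mulr_natl rpredMn | apply: IHs].
  move=> s; have := hdeg (enum 'I_r.+1) 0%N vol hvol s; rewrite addn0 big_enum /=.
  rewrite big_ord_recl {1}/frame_deg unlift_none.
  by under [X in (1 + X)%N]eq_bigr do rewrite /frame_deg liftK.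
- move=> s; apply/eqP; rewrite -tofrac_eq !rmorphM /=; apply/eqP.
  have := wPhi t; have := wPhi s; rewrite /wK => -> ->; ring.
- by apply: contraNneq wKt => P0; rewrite wPhi P0 rmorph0 mulr0.
Qed.

End Split.

(** * Generic lines *)

Section PolyFacts.
Variable K : fieldType.
Implicit Types p q : {poly K}.

Lemma irreducible_factor p : (1 < size p)%N -> exists2 q, irreducible_poly q & q %| p.
Proof.
move: {2}(size p) (leqnn (size p)) => m; elim: m p => [|m IH] p.
  by rewrite leqn0 => /eqP ->.
move=> pm p1; have [ip|nip] := pselect (irreducible_poly p); first by exists p.
have [q [q1 qp nqp]] : exists q, [/\ size q != 1%N, q %| p & ~~ (q %= p)].
  apply: contrapT => no; apply: nip; split=> // q q1 qp.
  by apply: contrapT => /negP nqp; apply: no; exists q.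
have p0 : p != 0 by rewrite -size_poly_gt0 ltnW.
have q0 : q != 0 by apply: contraTneq qp => ->; rewrite dvd0p.
have lt : (size q < size p)%N.
  by rewrite ltn_neqAle dvdp_leq // andbT; apply: contra nqp => e; rewrite -dvdp_size_eqp.
have [||f fi fq] := IH q; [lia | | by exists f => //; apply: dvdp_trans qp].
by rewrite ltn_neqAle eq_sym q1 size_poly_gt0.
Qed.

Lemma irreducible_prime p a b : irreducible_poly p -> p %| a * b -> p %| a \/ p %| b.
Proof.
move=> [p1 ip] pab; have [co|nco] := boolP (coprimep p a).
  by right; rewrite -(Gauss_dvdpr _ co).
left; have := ip (gcdp p a) nco (dvdp_gcdl _ _) => /eqp_dvdl <-.
exact: dvdp_gcdr.
Qed.

Lemma irreducible_ndvd1 p : irreducible_poly p -> ~~ (p %| 1).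
Proof. by move=> [p1 _]; rewrite dvdp1; apply: contraTneq p1 => ->. Qed.

Lemma irreducible_primeX p a N : irreducible_poly p -> p %| a ^+ N -> p %| a.
Proof.
move=> ip; elim: N => [|N IH]; first by rewrite expr0 (negbTE (irreducible_ndvd1 ip)).
by rewrite exprS => /(irreducible_prime ip)[].
Qed.

(** The powers of q are dependent modulo p, in a space of dimension deg p. *)
Lemma poly_dependence p q : p != 0 -> exists (m : nat) (a : 'I_m -> K),
  (exists i, a i != 0) /\ p %| \sum_i a i *: q ^+ i.
Proof.
move=> p0; pose d := (size p).-1.
pose A : 'M[K]_(d.+1, d) := \matrix_(i < d.+1) poly_rV (q ^+ i %% p).
have : kermx A != 0 by rewrite kermx_eq0 /row_free neq_ltn ltnS rank_leq_col.
case/rowV0Pn => a /sub_kermxP aA a0.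
exists d.+1, (fun i => a 0 i); split; first by apply/rV0Pn.
have sz r : (size (r %% p)%R <= d)%N by rewrite -ltnS /d prednK ?size_poly_gt0 // ltn_modp.
rewrite /dvdp (big_morph (fun r => r %% p) (modpD p) (mod0p p)); apply/eqP.
have := congr1 rVpoly aA; rewrite raddf0 => H; rewrite -[RHS]H mulmx_sum_row raddf_sum.
apply: eq_bigr => i _ /=; rewrite modpZl -(poly_rV_K (sz (q ^+ i))); apply/esym.
by rewrite linearZ /= rowK.
Qed.

End PolyFacts.

(** Some irreducible factor of b is not cancelled by a, for reasons of degree, and
must divide all the w s. *)
Lemma common_irreducible_factor (K : fieldType) (T : Type) (a b : {poly K}) (w f : T -> {poly K}) :
  a != 0 -> (size a < size b)%N -> (forall s, b * f s = a * w s) ->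
  exists2 pi, irreducible_poly pi & forall s, pi %| w s.
Proof.
move=> a0 ab E; have b0 : b != 0 by rewrite -size_poly_gt0; apply: leq_ltn_trans ab.
pose G := gcdp b a.
have co : coprimep (b %/ G) (a %/ G) by apply: coprimep_div_gcd; rewrite b0.
have G0 : G != 0 by rewrite gcdp_eq0 negb_and b0.
have sG : (1 < size (b %/ G)%R)%N.
  have := dvdp_leq a0 (dvdp_gcdr b a); rewrite -/G size_divp //.
  have : (0 < size G)%N by rewrite size_poly_gt0.
  move: (polyseq G) (polyseq a) (polyseq b) ab => g0 a1 b1.
  by move: (size g0) (size a1) (size b1) => [|x] y z yz //= _ xy;
    rewrite ltn_subRL addn1 (leq_trans _ yz).
have [pi ip pb] := irreducible_factor sG; exists pi => // s.
apply: dvdp_trans pb _; rewrite -(Gauss_dvdpr _ co).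
have -> : a %/ G * w s = b %/ G * f s; last exact: dvdp_mulr.
have E' : b %/ G * G * f s = a %/ G * G * w s.
  by rewrite !divpK ?dvdp_gcdl ?dvdp_gcdr.
by apply: (mulIf G0); rewrite mulrAC -E'; ring.
Qed.

Lemma dvdp_ideal (A : comNzRingType) (K : fieldType) (f : {rmorphism A -> {poly K}}) p :
  is_ideal (fun a => p %| f a).
Proof.
split=> [|a b ha hb|a b hb]; first by rewrite rmorph0 dvdp0.
  by rewrite rmorphD dvdp_add.
by rewrite rmorphM dvdp_mull.
Qed.

Lemma poly_relation (A : idomainType) (p g : {poly A}) : p != 0 ->
  exists (m : nat) (b : 'I_m -> A) (q : {poly A}),
    (exists i, b i != 0) /\ \sum_i (b i)%:P * g ^+ i = q * p.
Proof.
pose fr := map_poly (@tofrac A); have fr_inj : injective fr.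
  by apply: map_inj_poly (rmorph0 _) => x y /eqP; rewrite tofrac_eq => /eqP.
have frM a b : fr (a * b) = fr a * fr b by rewrite /fr rmorphM.
have frX a i : fr (a ^+ i) = fr a ^+ i by rewrite /fr rmorphXn.
have frC a : fr a%:P = (tofrac a)%:P by rewrite /fr map_polyC.
move=> p0; have fp0 : fr p != 0.
  by apply: contraNneq p0 => e; apply/eqP/fr_inj; rewrite e /fr rmorph0.
have [m [a [[i0 ai0] /dvdpP[q qE]]]] := poly_dependence (fr g) fp0.
have [D [a' [D0 ha]]] := common_denominator a.
have [D' [q' [D'0 hq]]] := poly_common_denominator q.
exists m, (fun i => D' * a' i), (D%:P * q'); split.
  by exists i0; rewrite mulf_eq0 negb_or D'0 -tofrac_eq0 -ha mulf_eq0 negb_or tofrac_eq0 D0 ai0.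
have frS (F : 'I_m -> {poly A}) : fr (\sum_i F i) = \sum_i fr (F i) by rewrite /fr rmorph_sum.
apply: fr_inj; rewrite !frM frC frS -[fr q']hq.
transitivity ((tofrac D' * tofrac D)%:P * \sum_i a i *: fr g ^+ i).
  rewrite mulr_sumr; apply: eq_bigr => i _ /=; rewrite frM frX frC.
  rewrite -mul_polyC mulrA -polyCM; congr (_%:P * _).
  by rewrite rmorphM /= -ha mulrA.
rewrite qE polyCM -mul_polyC; ring.
Qed.

Lemma mpoly_rmorph_ext (F : fieldType) (n : nat) (T : comNzRingType)
    (f g : {rmorphism mpoly n F -> T}) :
  (forall c, f (mpolyC n c) = g (mpolyC n c)) ->
  (forall i, f (mpolyX F (mnm1 i)) = g (mpolyX F (mnm1 i))) -> f =1 g.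
Proof.
move=> hC hX p; rewrite (mpolyE p) !rmorph_sum; apply: eq_bigr => m _.
rewrite -mul_mpolyC !rmorphM hC; congr (_ * _).
rewrite mpolyXE_id !rmorph_prod; apply: eq_bigr => i _.
by rewrite !rmorphXn /= hX.
Qed.

Section Lines.
Variables (R : realType) (n : nat).
Local Notation C := (CC R).
Local Notation S := (mpoly n.+1 C).
Local Notation I := 'I_n.+1.
Local Notation hom d p := (p \is ishomog1 d mdeg).
Local Notation var i := (mpolyX C (mnm1 (i : I)) : S).
Local Notation cst c := (mpolyC n.+1 (c : C) : S).

Variable v : 'rV[C]_n.+1.

(** The polynomial p(y + T v) in T: the restriction of p to the line with direction
v through the generic point y. *)
Definition on_line : S -> {poly S} :=
  mmap (polyC \o @mpolyC n.+1 C) (fun i => (var i)%:P + (cst (v 0 i))%:P * 'X).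
HB.instance Definition _ := GRing.RMorphism.on on_line.

Lemma on_lineC c : on_line (cst c) = (cst c)%:P.
Proof. by rewrite /on_line mmapC. Qed.

Lemma on_lineX i : on_line (var i) = (var i)%:P + (cst (v 0 i))%:P * 'X.
Proof. by rewrite /on_line mmapX mmap1U. Qed.

(** The coefficient of T^d is the value at the point at infinity v of the line. *)
Lemma on_line_hom d p : hom d p ->
  (size (on_line p) <= d.+1)%N /\ (on_line p)`_d = cst (evalp v p).
Proof.
pose Q d (q : {poly S}) a := (size q <= d.+1)%N /\ q`_d = cst a.
have QM d1 d2 q1 q2 a1 a2 : Q d1 q1 a1 -> Q d2 q2 a2 -> Q (d1 + d2)%N (q1 * q2) (a1 * a2).
  move=> [s1 c1] [s2 c2]; split.
    by apply: leq_trans (size_polyMleq _ _) _; lia.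
  have lt : (d1 < (d1 + d2).+1)%N by lia.
  rewrite coefM (bigD1 (Ordinal lt)) //= addKn c1 c2 big1 ?addr0 ?mpolyCM // => i ni.
  have [lti|gti|eqi] := ltngtP i d1.
  - by rewrite [X in _ * X]nth_default ?mulr0 //; apply: leq_trans s2 _; lia.
  - by rewrite nth_default ?mul0r //; apply: leq_trans s1 _.
  - by case/eqP: ni; apply: val_inj.
have QXn i k : Q k (on_line (var i) ^+ k) (v 0 i ^+ k).
  elim: k => [|k IH]; first by rewrite !expr0 /Q size_poly1 coef1 /=.
  rewrite !exprS -add1n; apply: QM => //; rewrite on_lineX; split.
    apply: leq_trans (size_polyD _ _) _; rewrite geq_max; apply/andP; split.
      by apply: leq_trans (size_polyC_leq1 _) _.
    by apply: leq_trans (size_polyMleq _ _) _; rewrite size_polyX addn2 ltnS;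
      exact: size_polyC_leq1.
  by rewrite coefD coefC coefCM coefX /= mulr1 add0r.
have Qm (m : multinom n.+1) : Q (mdeg m) (on_line (mpolyX C m)) (evalp v (mpolyX C m)).
  rewrite /evalp mevalX mpolyXE_id rmorph_prod mdegE.
  elim/big_rec3: _ => [|i a q d' _ IH]; first by rewrite /Q size_poly1 coef1.
  by rewrite rmorphXn /=; apply: QM.
move=> hp.
have -> : evalp v p = \sum_(m <- msupp p) meval (fun i => v 0 i) (mcoeff m p *: mpolyX C m).
  by rewrite /evalp {1}(mpolyE p) raddf_sum.
have -> : on_line p = \sum_(m <- msupp p) on_line (mcoeff m p *: mpolyX C m).
  by rewrite {1}(mpolyE p) rmorph_sum.
suff : Q d (\sum_(m <- msupp p) on_line (mcoeff m p *: mpolyX C m))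
  (\sum_(m <- msupp p) meval (fun i => v 0 i) (mcoeff m p *: mpolyX C m)) by [].
have : {in msupp p, forall m, mdeg m = d} by apply/dhomogP.
elim: (msupp p) => [|m s IH] ms; first by rewrite !big_nil /Q size_poly0 coef0 mpolyC0.
rewrite !big_cons; have [s1 c1] := IH (fun m' h => ms m' (mem_behead (s := m :: s) h)).
have [s2 c2] : Q d (on_line (mcoeff m p *: mpolyX C m))
                   (meval (fun i => v 0 i) (mcoeff m p *: mpolyX C m)).
  rewrite -mul_mpolyC mevalM mevalC rmorphM /= on_lineC -[d]add0n; apply: QM.
    by split; [apply: size_polyC_leq1 | rewrite coefC].
  by rewrite -(ms m (mem_head _ _)).
split; last by rewrite coefD c1 c2 mpolyCD.
by apply: leq_trans (size_polyD _ _) _; rewrite geq_max s1 s2.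
Qed.

Variable j0 : I.
Hypothesis vj0 : v 0 j0 != 0.

(** Composition with y |-> y' + s v, where y' is the projection of y along v to the
hyperplane y_j0 = 0.  The values of this map are the polynomials that are
constant along v; the parameter s is there so that no given polynomial is mapped
to 0 for all s. *)
Definition slice (s : C) : S -> S :=
  mmap (@mpolyC n.+1 C) (fun i => var i - cst (v 0 i / v 0 j0) * var j0 + cst (s * v 0 i)).
HB.instance Definition _ s := GRing.RMorphism.on (slice s).

Lemma sliceC s c : slice s (cst c) = cst c.
Proof. by rewrite /slice mmapC. Qed.

Lemma sliceX s i : slice s (var i) = var i - cst (v 0 i / v 0 j0) * var j0 + cst (s * v 0 i).
Proof. by rewrite /slice mmapX mmap1U. Qed.

Lemma on_line_slice s a : on_line (slice s a) = (slice s a)%:P.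
Proof.
apply: (mpoly_rmorph_ext (f := on_line \o slice s) (g := polyC \o slice s)) => [c|i] /=.
  by rewrite sliceC on_lineC.
rewrite sliceX !rmorphD !rmorphN !rmorphM /= !on_lineX !on_lineC.
have e : (cst (v 0 j0))%:P * (cst (v 0 j0)^-1)%:P = 1 :> {poly S}.
  by rewrite -rmorphM /= -mpolyCM mulfV //.
have aux (xi u T b' xj b t : {poly S}) : b * b' = 1 ->
    xi + u * T - u * b' * (xj + b * T) + t = xi - u * b' * xj + t.
  by move=> bb; rewrite mulrDr (_ : u * b' * (b * T) = u * T * (b * b')); [rewrite bb|]; ring.
exact: aux.
Qed.

(** The point y is recovered on the line through y' + s v at T = y_j0 / v_j0 - s. *)
Definition slice_back (s : C) : {poly S} -> S :=
  fun q => (map_poly (slice s) q).[cst (v 0 j0)^-1 * var j0 - cst s].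
HB.instance Definition _ s := GRing.RMorphism.copy (slice_back s)
  (horner_eval (cst (v 0 j0)^-1 * var j0 - cst s) \o map_poly (slice s)).

Lemma slice_backC s a : slice_back s a%:P = slice s a.
Proof. by rewrite /slice_back map_polyC hornerC. Qed.

Lemma slice_backK s p : slice_back s (on_line p) = p.
Proof.
apply: (mpoly_rmorph_ext (f := slice_back s \o on_line) (g := idfun)) => [c|i] /=.
  by rewrite on_lineC slice_backC sliceC.
rewrite on_lineX rmorphD rmorphM /= !slice_backC sliceC sliceX /slice_back map_polyX hornerX.
rewrite mulrBr mulrA -!mpolyCM [s * _]mulrC; ring.
Qed.

Lemma slice_neq0 (a : S) : a != 0 -> exists s, slice s a != 0.
Proof.
move=> /mpoly_nonzero_point[c ac]; exists (c 0 j0 / v 0 j0).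
apply: contraNneq ac => a0.
have <- : evalp c (slice (c 0 j0 / v 0 j0) a) = evalp c a.
  apply: (mpoly_rmorph_ext (f := meval _ \o slice (c 0 j0 / v 0 j0))
    (g := meval (fun i => c 0 i))) => [b|i] /=.
    by rewrite sliceC.
  rewrite sliceX mevalD mevalB mevalM !mevalXU !mevalC; field; exact: vj0.
by rewrite a0 /evalp meval0.
Qed.

End Lines.

(** * Hypersurfaces of singularities *)

Section Zariski.
Variables (R : realType) (n : nat).
Local Notation C := (CC R).
Local Notation S := (mpoly n.+1 C).
Local Notation K := {fraction S}.
Local Notation I := 'I_n.+1.
Local Notation hom d p := (p \is ishomog1 d mdeg).
Local Notation pih := (@pihomog n.+1 C mdeg).
Local Notation var i := (mpolyX C (mnm1 (i : I)) : S).
Local Notation cst c := (mpolyC n.+1 (c : C) : S).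

Lemma evalp_partition (x : 'rV[C]_n.+1) (h : S) c :
  evalp (c *: x) h = (\poly_(m < msize h) evalp x (pih m h)).[c].
Proof.
rewrite {1}(@pihomog_partitionE _ _ mdeg (msize h) h) // /evalp raddf_sum horner_poly /=.
apply: eq_bigr => m _; rewrite -!/(evalp _ _) mulrC.
by rewrite (evalpZ _ _ (@pihomogP _ _ mdeg m h)).
Qed.

Lemma closed_cone (Z : set (hpoint R n)) x c :
  zariski_closed Z -> Z x -> c != 0 -> Z (c *: x).
Proof.
move=> [F [Fh ->]] [x0 Fx] c0; split; first by rewrite scaler_eq0 negb_or c0.
by move=> p Fp; have [d hd] := Fh p Fp; rewrite (evalpZ _ _ hd) Fx ?mulr0.
Qed.

Lemma closed_neq0 (Z : set (hpoint R n)) x : zariski_closed Z -> Z x -> x != 0.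
Proof. by move=> [F [_ ->]] []. Qed.

Lemma closed_separate (Y Z : set (hpoint R n)) : zariski_closed Y -> zariski_closed Z ->
  ~ Z `<=` Y -> exists (p : S) (d : nat),
    [/\ hom d p, forall y, Y y -> evalp y p = 0 & exists2 z, Z z & evalp z p != 0].
Proof.
move=> [F [Fh YE]] cZ nZY; apply: contrapT => no; apply: nZY => z Zz.
rewrite YE; split=> [|p Fp]; first exact: closed_neq0 Zz.
apply: contrapT => /eqP pz; apply: no; have [d hd] := Fh p Fp.
exists p, d; split=> //; last by exists z.
by rewrite YE => y [_]; apply.
Qed.

(** Irreducibility is about homogeneous equations, while h is any polynomial: on a
cone, the vanishing of h along a line through the origin means that all its
homogeneous parts vanish there. *)
Lemma irreducible_cancel (Z : set (hpoint R n)) (g h : S) d : zariski_irreducible Z ->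
  hom d g -> (exists2 x, Z x & evalp x g != 0) ->
  (forall x, Z x -> evalp x (g * h) = 0) -> forall x, Z x -> evalp x h = 0.
Proof.
move=> [cZ _ irr] hg [x1 Zx1 gx1] gh.
pose Fg (p : S) := p = g.
pose Fh (p : S) := exists m, p = pih m h.
have [|||gZ|hZ] := irr [set x | x != 0 /\ forall p, Fg p -> evalp x p = 0]
                      [set x | x != 0 /\ forall p, Fh p -> evalp x p = 0].
- by exists Fg; split=> // p ->; exists d.
- by exists Fh; split=> // p [m ->]; exists m; apply: pihomogP.
- move=> x Zx; have x0 := closed_neq0 cZ Zx.
  have [gx|gx] := eqVneq (evalp x g) 0; [left|right]; split=> // p; first by move=> ->.
  move=> [m ->]; pose P : {poly C} := \poly_(m < msize h) evalp x (pih m h).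
  have Pz (c : C) : c != 0 -> P.[c] = 0.
    move=> c0; rewrite -evalp_partition.
    have := gh _ (closed_cone cZ Zx c0); rewrite /evalp mevalM -!/(evalp _ _) => /eqP.
    by rewrite mulf_eq0 (evalpZ _ _ hg) mulf_eq0 expf_eq0 (negbTE c0) andbF (negbTE gx) => /eqP.
  have P0 : P = 0.
    apply/eqP/negPn/negP => P0.
    have := max_poly_roots P0 (rs := [seq i.+1%:R | i <- iota 0 (size P)]).
    rewrite size_map size_iota ltnn => H; have : false; last by [].
    apply: H; first by apply/allP => c /mapP[i _ ->]; apply/rootP/Pz; rewrite pnatr_eq0.
    rewrite map_inj_uniq ?iota_uniq // => a b /eqP.
    by rewrite eqr_nat => /eqP[].
  have := congr1 (fun q : {poly C} => q`_m) P0; rewrite coef0 coef_poly.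
  case: ltnP => // le _; rewrite /pihomog big_seq_cond big1 ?/evalp ?meval0 // => m'.
  move=> /andP[m'h /eqP em].
  by have := msize_mdeg_lt m'h; rewrite em ltnNge le.
- by have [_ /(_ g erefl) gx0] := gZ x1 Zx1; rewrite gx0 eqxx in gx1.
- move=> x Zx; have [x0 hx] := hZ x Zx.
  rewrite -[x]scale1r evalp_partition horner_poly big1 // => m _.
  by rewrite hx ?mul0r //; exists m.
Qed.

Lemma evalp_horner0 (x : 'rV[C]_n.+1) (g : S) m (c : nat -> S) : evalp x g = 0 ->
  evalp x (\sum_(i < m.+1) c i * g ^+ i) = evalp x (c 0%N).
Proof.
move=> gx; rewrite big_ord_recl expr0 mulr1 /evalp mevalD.
rewrite [X in _ + X](_ : _ = 0) ?addr0 // raddf_sum big1 // => i _ /=.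
by rewrite exprS mulrCA mevalM -/(evalp x g) gx mul0r.
Qed.

Section GenericLine.
Variables (v : 'rV[C]_n.+1) (j0 : I).
Hypothesis vj0 : v 0 j0 != 0.

(** The restriction to the generic line with direction v, over the field of
rational functions of its base point. *)
Definition generic_line : S -> {poly K} := map_poly (@tofrac S) \o on_line v.
HB.instance Definition _ := GRing.RMorphism.copy generic_line (map_poly (@tofrac S) \o on_line v).

Lemma generic_line_inj p : p != 0 -> generic_line p != 0.
Proof.
apply: contraNneq => e; rewrite -(slice_backK v j0 0 p).
suff -> : on_line v p = 0 by rewrite rmorph0.
apply: (map_inj_poly (f := @tofrac S)); rewrite ?rmorph0 //.
by move=> a b /eqP; rewrite tofrac_eq => /eqP.
Qed.

(** Modulo p, the polynomial g is algebraic over the polynomials that are constant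
along v: on the generic line this is linear algebra, and [slice_back] brings the
relation back to the cone. *)
Lemma algebraic_relation (p g : S) : p != 0 -> exists (s : C) (m : nat) (b : 'I_m -> S) (q : S),
  (exists i, slice v j0 s (b i) != 0) /\ \sum_i slice v j0 s (b i) * g ^+ i = q * p.
Proof.
move=> p0; have lp0 : on_line v p != 0.
  by apply: contraNneq p0 => e; rewrite -(slice_backK v j0 0 p) e rmorph0.
have [m [b [q [[i bi] E]]]] := poly_relation (on_line v g) lp0.
have [s hs] := slice_neq0 vj0 bi.
exists s, m, b, (slice_back v j0 s q); split; first by exists i.
have := congr1 (slice_back v j0 s) E; rewrite rmorphM /= slice_backK // => <-.
rewrite rmorph_sum; apply: eq_bigr => k _.
by rewrite rmorphM rmorphXn /= slice_backC slice_backK.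
Qed.

Lemma generic_line_slice s a :
  generic_line (slice v j0 s a) = (tofrac (slice v j0 s a))%:P.
Proof. by rewrite /generic_line /= on_line_slice // map_polyC. Qed.

End GenericLine.

Section Hypersurface.
Variables (v : 'rV[C]_n.+1) (j0 : I).
Hypothesis n_gt0 : (0 < n)%N.

(* the two properties of the restriction to the generic line that the argument uses *)
Variable ps : {rmorphism S -> {poly K}}.
Hypothesis ps_slice : forall s a, ps (slice v j0 s a) = (tofrac (slice v j0 s a))%:P.
Hypothesis relation : forall p g : S, p != 0 ->
  exists (s : C) (m : nat) (b : 'I_m -> S) (q : S),
  (exists i, slice v j0 s (b i) != 0) /\ \sum_i slice v j0 s (b i) * g ^+ i = q * p.

Variable pi : {poly K}.
Hypothesis irr_pi : irreducible_poly pi.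

Definition pi_forms (p : S) := (exists d, hom d p) /\ pi %| ps p.
(** The hypersurface defined by the irreducible polynomial pi of the generic
line. *)
Definition pi_locus : set (hpoint R n) := [set x | x != 0 /\ forall p, pi_forms p -> evalp x p = 0].

(** The locus dominates the hyperplane along v: no nonzero polynomial constant
along v vanishes on it. *)
Lemma ndvd_slice s a : slice v j0 s a != 0 -> ~ pi %| ps (slice v j0 s a).
Proof.
move=> a0; rewrite ps_slice => /dvdpP[q e].
have t0 : tofrac (slice v j0 s a) != 0 by rewrite tofrac_eq0.
have /negP := irreducible_ndvd1 irr_pi; apply; apply/dvdpP.
exists ((tofrac (slice v j0 s a))^-1 *: q).
by rewrite -scalerAl -e -mul_polyC -rmorphM /= mulVf.
Qed.

(** The factor L, a linear form constant along v, takes care of the zero at the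
origin, which is not a point of the projective space; being constant along v it
is prime to pi. *)
Lemma pi_locus_null h : (forall x, pi_locus x -> evalp x h = 0) -> pi %| ps h.
Proof.
move=> hz.
have [i ij] : exists i, i != j0.
  have lt1 : (1 < n.+1)%N by [].
  have [->|] := eqVneq j0 ord0; last by rewrite eq_sym; exists ord0.
  by exists (Ordinal lt1).
pose L := slice v j0 0 (var i).
have LE : L = var i - cst (v 0 i / v 0 j0) * var j0.
  by rewrite /L sliceX mul0r mpolyC0 addr0.
have L0 : L != 0.
  apply/eqP => /(congr1 (mcoeff (mnm1 i))) /eqP.
  rewrite LE mcoeffB mul_mpolyC mcoeffZ !mcoeffXU eqxx [j0 == i]eq_sym (negbTE ij) mulr0 subr0.
  by rewrite mcoeff0 oner_eq0.
pose J (p : S) := forall J' : S -> Prop, is_ideal J' -> (forall q, pi_forms q -> J' q) -> J' p.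
have iJ : is_ideal J.
  split=> [J' i' _|a b Ja Jb J' i' F'|a b Jb J' i' F']; first exact: ideal0.
    by apply: idealD => //; [apply: Ja|apply: Jb].
  by apply: idealM => //; apply: Jb.
have [N JN] : exists N, J ((h * L) ^+ N).
  apply: contrapT => /forallNP aJ; have [c [Jc]] := nullstellensatz iJ aJ.
  rewrite /evalp mevalM mulf_eq0 negb_or => /andP[hc Lc]; case/negP: hc; apply/eqP.
  apply: hz; split=> [|p Fp]; last by apply: Jc => J' _; apply.
  by apply: contraNneq Lc => ->; rewrite LE mevalB mevalM !mevalXU !mxE mulr0 subr0.
have : pi %| ps ((h * L) ^+ N).
  by apply: (JN (fun p => pi %| ps p)) => [|q []//]; apply: dvdp_ideal.
rewrite rmorphXn => /(irreducible_primeX irr_pi); rewrite rmorphM.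
by case/(irreducible_prime irr_pi) => // /(ndvd_slice L0).
Qed.

Lemma pi_locus_closed : zariski_closed pi_locus.
Proof. by exists pi_forms; split=> // p []. Qed.

Lemma pi_locus_irreducible : zariski_irreducible pi_locus.
Proof.
split; first exact: pi_locus_closed.
  apply: contrapT => /forallNP no; have /negP := irreducible_ndvd1 irr_pi; apply.
  rewrite -(rmorph1 ps); apply: pi_locus_null => x lx; by case: (no x).
move=> A B cA cB AB; apply: contrapT => /not_orP[nA nB].
have [p [dp [hp pA [y ly py]]]] := closed_separate cA pi_locus_closed nA.
have [q [dq [hq qB [z lz qz]]]] := closed_separate cB pi_locus_closed nB.
have : pi %| ps (p * q).
  apply: pi_locus_null => x /AB[/pA|/qB]; rewrite /evalp mevalM => ->; by rewrite ?mul0r ?mulr0.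
rewrite rmorphM => /(irreducible_prime irr_pi)[dv|dv].
  by case/negP: py; apply/eqP; apply: ly.2; split=> //; exists dp.
by case/negP: qz; apply/eqP; apply: lz.2; split=> //; exists dq.
Qed.


(** In a relation between the powers of g on Y1, the constant term vanishes on the
locus of pi, where g = 0; so it is zero, and g can be cancelled because Y1 is
irreducible. *)
Lemma no_relation (Y1 : set (hpoint R n)) s (g : S) d : zariski_irreducible Y1 ->
  pi_locus `<=` Y1 -> hom d g -> (forall x, pi_locus x -> evalp x g = 0) ->
  (exists2 x, Y1 x & evalp x g != 0) ->
  forall m (b : nat -> S),
    (forall x, Y1 x -> evalp x (\sum_(i < m) slice v j0 s (b i) * g ^+ i) = 0) ->
  forall i : 'I_m, slice v j0 s (b i) = 0.
Proof.
move=> iY1 sub hg gz gY1; elim=> [|m IH] b hb; first by case.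
have b0 : slice v j0 s (b 0%N) = 0.
  apply/eqP/negPn/negP => /ndvd_slice; apply; apply: pi_locus_null => x lx.
  by rewrite -(evalp_horner0 m (fun i => slice v j0 s (b i)) (gz x lx)); apply/hb/sub.
have IHb : forall i : 'I_m, slice v j0 s (b i.+1) = 0.
  apply: (IH (fun i => b i.+1)); apply: (irreducible_cancel iY1 hg gY1) => x Y1x.
  have := hb x Y1x; rewrite big_ord_recl b0 mul0r add0r mulr_sumr.
  by congr (evalp x _ = 0); apply: eq_bigr => i _; rewrite /= exprS mulrCA.
by move=> i; have [j ->|->] := unliftP ord0 i; [exact: IHb | exact: b0].
Qed.

(** Suppose that Y1 lies strictly between the locus and another irreducible closed
set: some nonzero p vanishes on Y1, and some g vanishes on the locus but not on
Y1.  Then g satisfies on Y1 a nontrivial relation over the polynomials constant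
along v, which [no_relation] excludes. *)
Theorem pi_locus_codim : ~ codim_ge 2 pi_locus.
Proof.
move=> /(_ _ pi_locus_irreducible (fun x h => h)) [ch [c0 irr st]].
have iY1 := irr 1%N isT; have iY2 := irr 2%N isT.
have [sub01 n10] := st 0%N isT; have [sub12 n21] := st 1%N isT.
rewrite c0 in sub01 n10; have [cY1 _ _] := iY1; have [cY2 _ _] := iY2.
have [g [dg [hg gz gY1]]] := closed_separate pi_locus_closed cY1 n10.
have [p [dp [hp pY1 [z _ pz]]]] := closed_separate cY1 cY2 n21.
have p0 : p != 0 by apply: contraNneq pz => ->; rewrite /evalp meval0.
have [s [m [b [q [[i bi] E]]]]] := relation g p0.
case/negP: bi; apply/eqP.
pose b' k := if insub k is Some i then b i else 0.
have bE (k : 'I_m) : b' k = b k by rewrite /b' valK.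
rewrite -bE; apply: (no_relation iY1 sub01 hg gz gY1) => x Y1x.
under eq_bigr do rewrite bE.
by rewrite E /evalp mevalM -!/(evalp _ _) pY1 // mulr0.
Qed.

End Hypersurface.

(** The direction v is chosen with B(v) <> 0, so that B keeps its degree on the
generic line and cannot be cancelled by A there. *)
Theorem codim_common_factor T (w Phi : T -> S) (A B : S) a e (Z : set (hpoint R n)) :
  (0 < n)%N ->
  (forall s, hom e (w s)) -> hom a A -> hom e B -> A != 0 -> B != 0 -> (a < e)%N ->
  (forall s, B * Phi s = A * w s) ->
  [set x | x != 0 /\ forall s, evalp x (w s) = 0] `<=` Z -> ~ codim_ge 2 Z.
Proof.
move=> n0 hw hA hB A0 B0 ae E sZ cZ.
have [v Bv] := mpoly_nonzero_point B0.
have /rV0Pn[j0 vj0] : v != 0.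
  apply: contraNneq Bv => v0; have := evalpZ 0 v hB.
  by rewrite scale0r -v0 expr0n (gtn_eqF (leq_ltn_trans (leq0n a) ae)) mul0r => ->.
pose ps := generic_line v.
have psA : ps A != 0 by apply: (@generic_line_inj v j0).
have psB : ps B != 0 by apply: (@generic_line_inj v j0).
have sA : (size (ps A) <= a.+1)%N.
  by apply: leq_trans (size_poly _ _) _; have [] := on_line_hom v hA.
have sB : (e < size (ps B))%N.
  have [_ cB] := on_line_hom v hB.
  rewrite ltnNge; apply/negP => /(nth_default 0) /eqP.
  by rewrite coef_map /= cB tofrac_eq0 mpolyC_eq0 (negbTE Bv).
have sAB := leq_ltn_trans sA (leq_ltn_trans ae sB).
have [s|pi ip pw] := common_irreducible_factor psA sAB (w := ps \o w) (f := ps \o Phi).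
  have lM x y : generic_line v (x * y) = generic_line v x * generic_line v y by rewrite rmorphM.
  by have := congr1 (generic_line v) (E s); rewrite (lM B) (lM A).
have sl s a' := generic_line_slice vj0 s a'.
apply: (pi_locus_codim n0 (ps := generic_line v) sl (algebraic_relation vj0) ip) => Y iY YL.
apply: cZ iY _ => y Yy; apply: sZ.
have [y0 ly] := YL y Yy; split=> // s; apply: ly; split; [by exists e | exact: pw].
Qed.

End Zariski.

(** * The degree inequality *)

Lemma foliation_degree_nat (R : realType) (n : nat) (d : int) (X : vfield R n) :
  foliation d X -> exists m : nat, d = m%:Z.
Proof.
move=> [hX [x [x0 nsx]]]; case: d hX => [m _|m hX]; first by exists m.
by case: nsx; split=> //; exists 0 => i; rewrite hX /evalp meval0 mul0r.
Qed.

Lemma O_section_nat (R : realType) (n : nat) (m : int) (p : mpoly n.+1 (CC R)) :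
  O_section m p -> p != 0 -> exists e : nat, m = e%:Z.
Proof. by case: m => [e|e /= ->]; [exists e | rewrite eqxx]. Qed.

(** The invariance is assumed outside the singular sets; multiplying by a nonzero
coefficient of wD extends it to all points. *)
Lemma invariant_tangent (R : realType) (n k q : nat)
    (wD wG : diff_form n (mpoly n.+1 (CC R))) (X : vfield R n) :
  leaves_invariant q wG k wD -> (exists t, wD t != 0) -> tangent_to X wD ->
  contract X wG = fun=> 0.
Proof.
move=> [_ inv] [t wt0] tX; apply/funext => s; apply/eqP.
rewrite -(mulrI_eq0 _ (mulfI wt0)); apply/eqP/mpoly_eq0_punctured => x x0.
have ev (w : diff_form n (mpoly n.+1 (CC R))) u :
    evalp x (contract X w u) = contract (fun i => evalp x (X i)) (eval_form x w) u.
  by rewrite /evalp raddf_sum; apply: eq_bigr => i _; rewrite /= mevalM.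
rewrite /evalp mevalM -!/(evalp x _).
have [->|wtx] := eqVneq (evalp x (wD t)) 0; first by rewrite mul0r.
rewrite [X in _ * X](_ : _ = 0) ?mulr0 // ev.
have [[_ sG]|nsG] := pselect (pfaff_sing wG x).
  by rewrite /contract big1 // => i _; rewrite /eval_form sG mulr0.
apply: (inv x x0 _ nsG); first by case=> _ /(_ t) e; rewrite e eqxx in wtx.
by move=> u; rewrite -ev tX /evalp meval0.
Qed.

Theorem corollary1p3 (R : realType) (n k q r : nat) (lD lG : int)
    (wD wG : diff_form n (mpoly n.+1 (CC R)))
    (d : 'I_r -> int) (X : 'I_r -> vfield R n) :
  hol_distribution k lD wD ->
  (forall i, foliation (d i) (X i)) ->
  (forall i, isolated_singularities (X i)) ->
  (forall i, tangent_to (X i) wD) ->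
  tangent_sheaf_split wD d ->
  pfaff_system q lG wG ->
  leaves_invariant q wG k wD ->
  pfaff_degree k lD <= (n - k)%N%:Z * pfaff_degree q lG.
Proof.
move=> [[/andP[k0 kn] [kD hD RD] [t /eqP wt0]] dec codim _] fX isoX tX [Y [hY tY iso]].
move=> [/andP[q0 _] [kG hG RG] [t' /eqP wGt0]] inv.
have /choice[dn dE] := fun i => foliation_degree_nat (fX i).
have {}dE : d = fun i => (dn i)%:Z by apply/funext.
subst d.
have [e eE] := O_section_nat (hD t) wt0; have [eG eGE] := O_section_nat (hG t') wGt0.
rewrite eE in hD; rewrite eGE in hG.
case: k k0 kn kD dec eE inv => // k _ kn kD dec eE inv.
case: q q0 kG eGE inv => // q _ kG eGE inv.
have deg i : (dn i < eG)%N.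
  apply: (foliation_degree_lt (X := X i) (w := wG) (p := q)) => //.
  - by case: (fX i).
  - by apply/funext.
  - by apply: invariant_tangent inv _ (tX i); exists t.
  - by move=> w0; rewrite w0 eqxx in wGt0.
have [surj inj] := iso _ 1%N (x0_neq0 R n) (hom_x0 R n).
have [rE [Phi [hPhi E Phit0]]] : r = (n - k.+1)%N /\ exists Phi : diff_form n (mpoly n.+1 (CC R)),
    [/\ forall s, Phi s \is ishomog1 (1 + \sum_i dn i)%N mdeg,
        forall s, wD t * Phi s = Phi t * wD s & Phi t != 0].
  apply: (@split_tangent_sheaf_form R n r dn Y hY inj k e wD kD hD _ _ dec surj t wt0).
  - by apply/funext.
  - by move=> i; apply/funext/tY.
have n0 : (0 < n)%N by apply: leq_ltn_trans kn.
have eD : (e <= 1 + \sum_i dn i)%N.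
  rewrite leqNgt; apply/negP => lt.
  by apply: (codim_common_factor n0 hD (hPhi t) (hD t) Phit0 wt0 lt E _ codim) => x.
rewrite /pfaff_degree eE eGE.
have i0 : 'I_r by rewrite rE; exists 0%N; rewrite subn_gt0.
have sum : (\sum_i dn i <= r * eG.-1)%N.
  rewrite -[X in (_ <= X * _)%N]card_ord -sum_nat_const; apply: leq_sum => i _.
  by have := deg i; lia.
have := deg i0; rewrite -rE; nia.
Qed.
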